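(* For every integer $n>0$, the $\mathfrak{gl}(4,\mathbb{C})$-modules of polynomial $n$-regular functions $(\pi_{nl},\mathcal{F}^{+}_n)$, $(\pi_{nl},\mathcal{F}^{-}_n)$, $(\pi_{nr},\mathcal{G}^{+}_n)$ and $(\pi_{nr},\mathcal{G}^{-}_n)$ remain irreducible after restriction to $\mathfrak{sp}(4,\mathbb{C})$.
   Context: Let $\mathbb{H}_{\mathbb{C}}$ be the algebra of complex $2\times2$ matrices $Z=\begin{pmatrix} z_{11} & z_{12} \\ z_{21} & z_{22} \end{pmatrix}$, $N(Z)=\det Z$. Let $\mathbb{S}=\mathbb{C}^2$ (columns, left $\mathbb{H}_{\mathbb{C}}$-module) and $\mathbb{S}'=\mathbb{C}^2$ (rows, right $\mathbb{H}_{\mathbb{C}}$-module). Write $\partial_{ij}=\partial/\partial z_{ij}$, $\partial=\begin{pmatrix} \partial_{11} & \partial_{21} \\ \partial_{12} & \partial_{22} \end{pmatrix}$ and $\nabla^+=2\begin{pmatrix} \partial_{22} & -\partial_{21} \\ -\partial_{12} & \partial_{11} \end{pmatrix}$. For an operator or matrix $X$ let $X_{(k)}=1\otimes\cdots\otimes X\otimes\cdots\otimes1$ ($X$ in the $k$-th of $n$ tensor factors). A function $f$ with values in the $n$-th symmetric power $\mathbb{S}^{\odot n}\subset\mathbb{S}^{\otimes n}$ is left $n$-regular if $\nabla^+_{(k)}f=0$ for $k=1,\dots,n$; a function $g$ with values in $\mathbb{S}'^{\odot n}$ is right $n$-regular if $g\overleftarrow{\nabla^+_{(k)}}=0$ (operator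 applied, with matrix multiplication, on the right) for $k=1,\dots,n$. $\mathcal{F}^+_n$ is the space of left $n$-regular $f\in\mathbb{S}^{\odot n}\otimes\mathbb{C}[z_{11},z_{12},z_{21},z_{22}]$; $\mathcal{F}^-_n$ is the space of $f\in\mathbb{S}^{\odot n}\otimes\mathbb{C}[z_{11},z_{12},z_{21},z_{22},N(Z)^{-1}]$ such that $N(Z)^{-1}(Z^{-1})^{\otimes n}f(Z^{-1})\in\mathcal{F}^+_n$. $\mathcal{G}^+_n$ is the space of right $n$-regular $g\in\mathbb{S}'^{\odot n}\otimes\mathbb{C}[z_{11},z_{12},z_{21},z_{22}]$; $\mathcal{G}^-_n$ is the space of $g\in\mathbb{S}'^{\odot n}\otimes\mathbb{C}[z_{ij},N(Z)^{-1}]$ such that $N(Z)^{-1}g(Z^{-1})(Z^{-1})^{\otimes n}\in\mathcal{G}^+_n$. The Lie algebra $\mathfrak{gl}(2,\mathbb{H}_{\mathbb{C}})=\mathfrak{gl}(4,\mathbb{C})$, with elements written as $2\times2$ blocks $\begin{pmatrix} A & B \\ C & D \end{pmatrix}$, acts on left $n$-regular functions by $\pi_{nl}(A)f=-\mathrm{Tr}(AZ\partial)f$, $\pi_{nl}(B)f=-\mathrm{Tr}(B\partial)f$, $\pi_{nl}(C)f=\mathrm{Tr}(ZCZ\partial+CZ)f+\sum_k(CZ)_{(k)}f$, $\pi_{nl}(D)f=\mathrm{Tr}(ZD\partial+D)f+\sum_kD_{(k)}f$, and on right $n$-regular functions by $\pi_{nr}(A)g=-\mathrm{Tr}(AZ\partial+A)g-\sum_k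 gA_{(k)}$, $\pi_{nr}(B)g=-\mathrm{Tr}(B\partial)g$, $\pi_{nr}(C)g=\mathrm{Tr}(ZCZ\partial+ZC)g+\sum_k g(ZC)_{(k)}$, $\pi_{nr}(D)g=\mathrm{Tr}(ZD\partial)g$ (here $A$ stands for $\begin{pmatrix} A & 0 \\ 0 & 0 \end{pmatrix}$, etc.). The spaces $\mathcal{F}^\pm_n$, $\mathcal{G}^\pm_n$ are invariant. The subalgebra is $\mathfrak{sp}(4,\mathbb{C})=\left\{\begin{pmatrix} A & B \\ C & -A^T \end{pmatrix}:\ B^T=B,\ C^T=C\right\}\subset\mathfrak{gl}(4,\mathbb{C})$. *)

(* Defs.v *)
From HB Require Import structures.
From mathcomp Require Import all_boot all_order all_algebra all_fingroup.
From mathcomp Require Import generic_quotient fraction mpoly ring.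
From mathcomp Require Import reals complex.

Set Implicit Arguments.
Unset Strict Implicit.
Unset Printing Implicit Defensive.

Import GRing.Theory.
Local Open Scope ring_scope.

(* C[z_11, z_12, z_21, z_22]: the variable z_ij is 'X_(mxvec_index i j), and the
   matrix indices 1, 2 are the elements 0, 1 of 'I_2. *)
Notation zpoly C := {mpoly C[2 * 2]}.

(* C(z_11, z_12, z_21, z_22). The rings C[z_ij] and C[z_ij, N(Z)^-1] are the
   subrings [is_poly] and [is_laurent] of this field. *)
Notation zfrac C := {fraction {mpoly C[2 * 2]}}.

(* (C^2)^{(x) n} (x) C(z_ij), in coordinates: the coefficient of
   e_(I 0) (x) ... (x) e_(I n.-1) is [f I]. The same type serves for columns and
   for rows. *)
Notation tens C n := {ffun {ffun 'I_n -> 'I_2} -> zfrac C}.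

Section Coordinates.
Variable C : fieldType.
Local Notation P := (zpoly C).
Local Notation K := (zfrac C).

Definition pfrac (p : P) : K := FracField.tofrac p.
HB.instance Definition _ := GRing.RMorphism.copy pfrac (@FracField.tofrac P).

Definition cst (c : C) : K := pfrac c%:MP.
HB.instance Definition _ :=
  GRing.RMorphism.copy cst (pfrac \o @mpolyC (2 * 2) C).

Definition Zmx : 'M[K]_2 := \matrix_(i, j) pfrac 'X_(mxvec_index i j).
Definition Nz : K := \det Zmx.

Definition is_poly (x : K) : Prop := exists p : P, x = pfrac p.
Definition is_laurent (x : K) : Prop :=
  exists (p : P) (k : nat), x = pfrac p / Nz ^+ k.

(* d/dz_ij, by the quotient rule on a representative; [pdE] shows that the
   representative is irrelevant. *)
Definition pd (i j : 'I_2) (x : K) : K :=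
  let p := \n_(repr x) in let q := \d_(repr x) in let m := mxvec_index i j in
  pfrac (p^`M(m) * q - p * q^`M(m)) / pfrac (q ^+ 2).

(* x(W). Meaningful when no denominator vanishes at W (see [zsubstE]); it is
   used only for W = Z^-1, where Z |-> Z^-1 is an automorphism of C(z_ij). *)
Definition zsubst (W : 'M[K]_2) (x : K) : K :=
  let ev (p : P) : K := mmap cst (fun m => mxvec W 0 m) p in
  ev \n_(repr x) / ev \d_(repr x).

Lemma pfrac_eq0 p : (pfrac p == 0) = (p == 0).
Proof. exact: tofrac_eq0. Qed.

Lemma pfracM p q : pfrac (p * q) = pfrac p * pfrac q.
Proof. exact: tofracM. Qed.

Lemma fracE (x : K) : x = pfrac \n_(repr x) / pfrac \d_(repr x).
Proof.
have d0 : pfrac \d_(repr x) != 0 by rewrite pfrac_eq0 denom_ratioP.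
apply: (mulIf d0); rewrite divfK //.
set r := repr x; rewrite -[x]reprK -/r.
rewrite /pfrac; unlock FracField.tofrac; rewrite -[LHS]FracField.pi_mul.
apply/eqmodP; rewrite /= FracField.equivfE /FracField.mulf.
rewrite ?numden_Ratio ?oner_eq0 ?mulf_neq0 ?denom_ratioP //;
  do ?exact: oner_neq0.
by rewrite !mulr1 mulrC.
Qed.

Lemma frac_cross (p q : P) : q != 0 ->
  let x := pfrac p / pfrac q in \n_(repr x) * q = p * \d_(repr x).
Proof.
move=> q0 x; have := fracE x; rewrite {1}/x => /eqP.
rewrite eqr_div ?pfrac_eq0 ?denom_ratioP // -!pfracM tofrac_eq => /eqP Ex.
by [].
Qed.

Lemma pdE (i j : 'I_2) (p q : P) : q != 0 -> let m := mxvec_index i j in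
  pd i j (pfrac p / pfrac q)
  = pfrac (p^`M(m) * q - p * q^`M(m)) / pfrac (q ^+ 2).
Proof.
move=> q0 m; have := frac_cross p q0; rewrite /pd /= -/m.
set a := \n_(_); set b := \d_(_) => E.
have b0 : b != 0 by exact: denom_ratioP.
have E' := congr1 (mderiv m) E; rewrite !mderivM in E'.
apply/eqP; rewrite eqr_div ?pfrac_eq0 ?expf_neq0 // -!pfracM tofrac_eq.
rewrite -subr_eq0; apply/eqP.
transitivity (b * q * ((a^`M(m) * q + a * q^`M(m)) - (p^`M(m) * b + p * b^`M(m)))
              - (b^`M(m) * q + b * q^`M(m)) * (a * q - p * b)); first by ring.
by rewrite E E' !subrr !mulr0 subrr.
Qed.

Lemma zsubstE (W : 'M[K]_2) (p q : P) :
  let ev (r : P) : K := mmap cst (fun m => mxvec W 0 m) r in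
  (forall r, r != 0 -> ev r != 0) -> q != 0 ->
  zsubst W (pfrac p / pfrac q) = ev p / ev q.
Proof.
move=> ev ev0 q0; rewrite /zsubst; have /= := frac_cross p q0.
set a := \n_(_); set b := \d_(_) => E.
have b0 : b != 0 by exact: denom_ratioP.
have evM r s : ev (r * s) = ev r * ev s by exact: rmorphM.
apply/eqP; rewrite eqr_div ?ev0 // -/(ev a) -/(ev q) -!evM E mulrC.
by [].
Qed.

Definition mx22 (T : Type) (a b c d : T) : 'M[T]_2 :=
  \matrix_(i, j) if i == 0 then (if j == 0 then a else b)
                 else (if j == 0 then c else d).

Definition Dmx : 'M[K -> K]_2 := mx22 (pd 0 0) (pd 1 0) (pd 0 1) (pd 1 1).

Definition nabla_plus : 'M[K -> K]_2 :=
  mx22 (fun x => 2 * pd 1 1 x)     (fun x => - (2 * pd 1 0 x))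
       (fun x => - (2 * pd 0 1 x)) (fun x => 2 * pd 0 0 x).

(* A matrix over K, acting by multiplication. *)
Definition mulop (X : 'M[K]_2) : 'M[K -> K]_2 := map_mx *%R X.

(* Tr(X d): the coefficients of X stand to the left of the derivatives. *)
Definition trD (X : 'M[K]_2) (x : K) : K :=
  \sum_i \sum_j X i j * Dmx j i x.

Section Tensors.
Variable n : nat.
Local Notation idx := {ffun 'I_n -> 'I_2}.
Local Notation T := (tens C n).
Implicit Types (f g : T) (k : 'I_n).

Definition put (I : idx) k (j : 'I_2) : idx :=
  [ffun l => if l == k then j else I l].

(* X_(k) f, and g X_(k) with X acting from the right. *)
Definition slotl (X : 'M[K -> K]_2) k f : T :=
  [ffun I : idx => \sum_j X (I k) j (f (put I k j))].
Definition slotr (X : 'M[K -> K]_2) k g : T :=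
  [ffun I : idx => \sum_j X j (I k) (g (put I k j))].

(* X^{(x) n} f and g X^{(x) n}. *)
Definition tpowl (X : 'M[K]_2) f : T :=
  [ffun I : idx => \sum_(J : idx) (\prod_k X (I k) (J k)) * f J].
Definition tpowr (X : 'M[K]_2) g : T :=
  [ffun I : idx => \sum_(J : idx) g J * (\prod_k X (J k) (I k))].

Definition entrywise (D : K -> K) f : T := [ffun I : idx => D (f I)].
Definition scale (x : K) f : T := [ffun I : idx => x * f I].
Local Notation "x *: f" := (scale x f) : ring_scope.

Definition is_symmetric f : Prop :=
  forall (s : 'S_n) (I : idx), f [ffun k => I (s k)] = f I.

Definition left_regular f : Prop := forall k, slotl nabla_plus k f = 0.
Definition right_regular g : Prop := forall k, slotr nabla_plus k g = 0.

Definition invl f : T :=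
  Nz^-1 *: tpowl (invmx Zmx) (entrywise (zsubst (invmx Zmx)) f).
Definition invr g : T :=
  Nz^-1 *: tpowr (invmx Zmx) (entrywise (zsubst (invmx Zmx)) g).

Definition Fplus f : Prop :=
  [/\ is_symmetric f, forall I, is_poly (f I) & left_regular f].
Definition Fminus f : Prop :=
  [/\ is_symmetric f, forall I, is_laurent (f I) & Fplus (invl f)].
Definition Gplus g : Prop :=
  [/\ is_symmetric g, forall I, is_poly (g I) & right_regular g].
Definition Gminus g : Prop :=
  [/\ is_symmetric g, forall I, is_laurent (g I) & Gplus (invr g)].

(* The element of gl(4) with blocks A, B, C, D is the matrix X; the block C is
   called Cm below. *)
Definition pi_nl (X : 'M[C]_(2 + 2)) f : T :=
  let A := map_mx cst (ulsubmx X) in let B := map_mx cst (ursubmx X) in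
  let Cm := map_mx cst (dlsubmx X) in let D := map_mx cst (drsubmx X) in
  - entrywise (trD (A *m Zmx)) f
  - entrywise (trD B) f
  + (entrywise (trD (Zmx *m Cm *m Zmx)) f + \tr (Cm *m Zmx) *: f
     + \sum_k slotl (mulop (Cm *m Zmx)) k f)
  + (entrywise (trD (Zmx *m D)) f + \tr D *: f
     + \sum_k slotl (mulop D) k f).

Definition pi_nr (X : 'M[C]_(2 + 2)) g : T :=
  let A := map_mx cst (ulsubmx X) in let B := map_mx cst (ursubmx X) in
  let Cm := map_mx cst (dlsubmx X) in let D := map_mx cst (drsubmx X) in
  - (entrywise (trD (A *m Zmx)) g + \tr A *: g) - \sum_k slotr (mulop A) k g
  - entrywise (trD B) g
  + (entrywise (trD (Zmx *m Cm *m Zmx)) g + \tr (Zmx *m Cm) *: g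
     + \sum_k slotr (mulop (Zmx *m Cm)) k g)
  + entrywise (trD (Zmx *m D)) g.

Definition subspace (V : T -> Prop) : Prop :=
  V 0 /\ forall (c : C) f g, V f -> V g -> V (cst c *: f + g).

Definition submodule (L : 'M[C]_(2 + 2) -> Prop)
    (act : 'M[C]_(2 + 2) -> T -> T) (V : T -> Prop) : Prop :=
  subspace V /\ forall X f, L X -> V f -> V (act X f).

Definition irreducible (L : 'M[C]_(2 + 2) -> Prop)
    (act : 'M[C]_(2 + 2) -> T -> T) (V : T -> Prop) : Prop :=
  [/\ submodule L act V,
      exists f, V f /\ f <> 0 &
      forall W, submodule L act W -> (forall f, W f -> V f) ->
        (forall f, W f -> f = 0) \/ (forall f, V f -> W f)].

End Tensors.

Definition sp4 (X : 'M[C]_(2 + 2)) : Prop :=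
  exists A B Cm : 'M[C]_2,
    [/\ B^T = B, Cm^T = Cm & X = block_mx A B Cm (- A^T)].

End Coordinates.

(* Main.v *)
(* A regular polynomial f in F+ behaves like a polynomial in x_0, x_1, y_0, y_1
   which is of degree n higher in y than in x: gl(4) acts by d/dx_a d/dy_b
   (block B), y_a x_b (block C), x_b d/dx_c (block A) and y_a d/dy_e (block D).
   This rests on one identity for regular f, which says that the operator of C
   composed with d/dz_ij factors into a row operator and a column operator.

   A nonzero submodule W of F+ contains a nonzero vector killed by the symmetric
   part of block B. For n > 0 the regularity equations then annihilate all the
   derivatives, so the vector is constant, and GL(2) gives all the constants.
   By induction on the degree, F+ is contained in W: on a weight vector f the
   operator C_aa B_aa is multiplication by (x_a-degree)(y_a-degree), which recovers
   f from its derivatives unless both products vanish. Such an extremal weight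
   x_a^d y_b^(d+n) is reached by C_ab + C_ba, modulo weights already treated.

   The inversion Z |-> Z^-1 exchanges F+ with F- and, on sp(4), conjugates the
   action by (A, B, C, D) |-> (D, C, B, A). The transposition Z |-> Z^T exchanges
   F with G, left with right, and is compatible with the identity of sp(4). *)
Require Import Defs.
From HB Require Import structures.
From mathcomp Require Import all_boot all_order all_algebra all_fingroup.
From mathcomp Require Import generic_quotient fraction mpoly ring.
From mathcomp Require Import boolp reals complex.

Set Implicit Arguments.
Unset Strict Implicit.
Unset Printing Implicit Defensive.

Import GRing.Theory Num.Theory.
Local Open Scope ring_scope.

(** * Differential calculus on C(z_ij) and substitutions *)

(** The obstacle is how little of gl(4) is left in sp(4). Its GL(2) acts only by [rowop b a] +
    [colop b a], so row and column weights cannot be separated inside a submodule W. What W does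
    split by is the total degree, because the two diagonal operators add up to 2 [euler] + n, and,
    on constants only, the column weights, because [rowop] vanishes there. The finer splitting
    therefore takes place in F+ itself: a simultaneous weight vector of degree m+1, not assumed to
    lie in W, is recovered up to a nonzero factor from its derivatives, which have degree m and lie
    in W by induction. The factorization of [raiseop] after [shiftop] comes from the relations d_ab
    d_ce = d_ae d_cb, that is, from the harmonicity of each component, which regularity yields as
    soon as there is one tensor slot. A slot is also what separates d_01 from d_10 when only their
    sum is available: for n = 0 the nonconstant polynomial z_01 - z_10 would be killed by the
    symmetric part of block B. *)

Lemma quotient_ruleD (F : fieldType) (a b a' b' c d c' d' : F) :
  b != 0 -> d != 0 ->
  ((a' * d + a * d' + (c' * b + c * b')) * (b * d)
   - (a * d + c * b) * (b' * d + b * d')) / (b * d) ^+ 2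
  = (a' * b - a * b') / b ^+ 2 + (c' * d - c * d') / d ^+ 2.
Proof. by move=> b0 d0; field; rewrite b0 d0. Qed.

Lemma quotient_ruleM (F : fieldType) (a b a' b' c d c' d' : F) :
  b != 0 -> d != 0 ->
  ((a' * c + a * c') * (b * d) - a * c * (b' * d + b * d')) / (b * d) ^+ 2
  = (a' * b - a * b') / b ^+ 2 * (c / d) + a / b * ((c' * d - c * d') / d ^+ 2).
Proof. by move=> b0 d0; field; rewrite b0 d0. Qed.

(** The mixed terms are symmetric in [d] and [e] and cancel, so that commutation of two derivations
    can be tested on generators. *)
Lemma commutator_Leibniz (F : comNzRingType) (d e : F -> F) :
  {morph d : x y / x + y} -> {morph e : x y / x + y} ->
  (forall x y, d (x * y) = d x * y + x * d y) ->
  (forall x y, e (x * y) = e x * y + x * e y) ->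
  forall x y, d (e (x * y)) - e (d (x * y))
    = (d (e x) - e (d x)) * y + x * (d (e y) - e (d y)).
Proof. by move=> dD eD dM eM x y; rewrite dM eM dD eD !dM !eM; ring. Qed.

Lemma chain_rule_cancel (F : comNzRingType) (a b c e J : F) :
  (a * b + c * e) * J - c * (e * J) = a * J * b.
Proof. by ring. Qed.

Lemma cstE (C : fieldType) (c : C) : cst c = pfrac c%:MP.
Proof. by []. Qed.

Opaque pd zsubst pfrac cst.

Section Calculus.
Variable C : numFieldType.
Local Notation P := (zpoly C).
Local Notation K := (zfrac C).
Local Notation z i j := (@Zmx C i j).

(** * Generalities on multivariate polynomials and matrix indices *)

Lemma mpoly_ring_ind (m : nat) (R : nzRingType) (Q : {mpoly R[m]} -> Prop) :
  (forall c, Q c%:MP) -> (forall u, Q 'X_u) ->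
  (forall p q, Q p -> Q q -> Q (p + q)) ->
  (forall p q, Q p -> Q q -> Q (p * q)) -> forall p, Q p.
Proof.
move=> QC QX QD QM p; rewrite [p]mpolyE.
apply: (big_ind Q) => [||u _]; [by rewrite -mpolyC0| exact: QD|].
rewrite -mul_mpolyC; apply: (QM) => //; rewrite mpolyXE_id.
apply: (big_ind Q) => [||i _]; [by rewrite -mpolyC1| exact: QM|].
elim: (u i) => [|e IHe]; first by rewrite expr0 -mpolyC1.
by rewrite exprS; apply: QM.
Qed.

Lemma mderivXU (m : nat) (R : nzRingType) (u v : 'I_m) :
  ('X_u : {mpoly R[m]})^`M(v) = (u == v)%:R.
Proof.
rewrite mderivX mnm1E; case: eqP => [->|_]; last by rewrite scale0r.
by rewrite -{1}[U_(v)%MM]add0m addmK mpolyX0 scale1r.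
Qed.

Lemma mderiv_eq0_const (R : numDomainType) (m : nat) (p : {mpoly R[m]}) :
  (forall u, p^`M(u) = 0) -> p = (p@_0%MM)%:MP.
Proof.
move=> dp; apply/mpolyP => u; rewrite mcoeffC.
case: eqP => [<-|/eqP u0]; first by rewrite mulr1.
have [i ui] : exists i, u i != 0%N.
  apply/existsP; apply: contraR u0; rewrite negb_exists => /forallP u0.
  by apply/eqP/mnmP => i; rewrite mnm0E; have := u0 i; rewrite negbK => /eqP.
have := congr1 (mcoeff (u - U_(i))%MM) (dp i).
rewrite mcoeff_deriv mcoeff0 submK; last first.
  by apply/mnm_lepP => k; rewrite mnm1E; case: eqP => // <-; rewrite lt0n.
by move/eqP; rewrite mulrn_eq0 /= mulr0 => /eqP.
Qed.

Lemma msize_mderiv (R : numDomainType) (m : nat) (p : {mpoly R[m]}) u :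
  p^`M(u) != 0 -> (msize p^`M(u) < msize p)%N.
Proof.
move=> dp0; rewrite -mlead_deg //.
have : mlead p^`M(u) \in msupp p^`M(u) by exact: mlead_supp.
rewrite mcoeff_msupp mcoeff_deriv mulrn_eq0 /=.
by rewrite -mcoeff_msupp => /msize_mdeg_lt; rewrite mdegD mdeg1 addn1.
Qed.

Lemma sum_mxvec_index (V : nmodType) (m k : nat) (F : 'I_(m * k) -> V) :
  \sum_u F u = \sum_i \sum_j F (mxvec_index i j).
Proof.
rewrite pair_big (reindex _ (curry_mxvec_bij _ _)) /=.
by apply: eq_bigr => -[i j] _.
Qed.

Lemma mxvec_index_inj (m k : nat) (i i' : 'I_m) (j j' : 'I_k) :
  (mxvec_index i j == mxvec_index i' j') = (i == i') && (j == j').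
Proof.
apply/eqP/andP => [|[/eqP-> /eqP->] //]; rewrite /mxvec_index.
by move/cast_ord_inj/enum_rank_inj => [-> ->].
Qed.

Implicit Types (x y : K) (p q : P) (i j k l : 'I_2).

(** * The partial derivatives as commuting derivations of the fraction field *)

Lemma ZmxE i j : z i j = pfrac 'X_(mxvec_index i j).
Proof. by rewrite mxE. Qed.

Lemma pfracD p q : pfrac (p + q) = pfrac p + pfrac q.
Proof. exact: rmorphD. Qed.

Lemma frac_rep x : exists p q, q != 0 /\ x = pfrac p / pfrac q.
Proof.
exists \n_(repr x), \d_(repr x).
split; [exact: denom_ratioP|exact: fracE].
Qed.

Lemma pd_frac i j p q : q != 0 ->
  pd i j (pfrac p / pfrac q) =
  (pfrac p^`M(mxvec_index i j) * pfrac q - pfrac p * pfrac q^`M(mxvec_index i j))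
  / pfrac q ^+ 2.
Proof.
move=> q0; rewrite (pdE i j p q0) /= !pfracM rmorphB /= !pfracM.
by [].
Qed.

Lemma pd_pfrac i j p : pd i j (pfrac p) = pfrac p^`M(mxvec_index i j).
Proof.
rewrite -[pfrac p]divr1 -(rmorph1 (@pfrac C)) pd_frac ?oner_eq0 //.
by rewrite -mpolyC1 mderivC !rmorph1 rmorph0 mulr0 subr0 mulr1 expr1n divr1.
Qed.

Lemma pdD i j : {morph @pd C i j : x y / x + y}.
Proof.
move=> x y; have [p [q [q0 ->]]] := frac_rep x.
have [r [s [s0 ->]]] := frac_rep y.
have Q0 : pfrac q != 0 by rewrite pfrac_eq0.
have S0 : pfrac s != 0 by rewrite pfrac_eq0.
rewrite (addf_div _ _ Q0 S0) -!pfracM -pfracD.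
rewrite (pd_frac _ _ _ (mulf_neq0 q0 s0)) (pd_frac _ _ _ q0) (pd_frac _ _ _ s0).
rewrite mderivD !mderivM !(pfracD, pfracM).
by rewrite (quotient_ruleD _ _ _ _ _ _ Q0 S0).
Qed.

Lemma pdM i j x y : pd i j (x * y) = pd i j x * y + x * pd i j y.
Proof.
have [p [q [q0 ->]]] := frac_rep x.
have [r [s [s0 ->]]] := frac_rep y.
have Q0 : pfrac q != 0 by rewrite pfrac_eq0.
have S0 : pfrac s != 0 by rewrite pfrac_eq0.
rewrite mulf_div -!pfracM.
rewrite (pd_frac _ _ _ (mulf_neq0 q0 s0)) (pd_frac _ _ _ q0) (pd_frac _ _ _ s0).
rewrite !mderivM !(pfracD, pfracM).
by rewrite (quotient_ruleM _ _ _ _ _ _ Q0 S0).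
Qed.

Lemma pd_cst i j (c : C) : pd i j (cst c) = 0.
Proof. by rewrite cstE pd_pfrac mderivC rmorph0. Qed.

Lemma pd0 i j : pd i j (0 : K) = 0.
Proof. by rewrite -(rmorph0 (@cst C)) pd_cst. Qed.

Lemma pdN i j : {morph @pd C i j : x / - x}.
Proof. by move=> x; apply: (addrI (pd i j x)); rewrite -pdD !subrr pd0. Qed.

HB.instance Definition _ i j :=
  GRing.isNmodMorphism.Build K K (@pd C i j) (pd0 i j, pdD i j).

Lemma pd_z i j k l : pd i j (z k l) = ((i == k) && (j == l))%:R.
Proof.
by rewrite ZmxE pd_pfrac mderivXU mxvec_index_inj eq_sym [l == j]eq_sym rmorph_nat.
Qed.

Lemma cst_nat (m : nat) : cst m%:R = m%:R :> K.
Proof. exact: rmorph_nat. Qed.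

Lemma natK_eq0 (m : nat) : (m%:R == 0 :> K) = (m == 0%N).
Proof. by rewrite -cst_nat fmorph_eq0 pnatr_eq0. Qed.

(** Vanishing on generators gives vanishing on polynomials. For a fraction, apply [D] to x q = p:
    all that remains is D x * s q = 0, and [s q] is nonzero. *)
Lemma der_eq0 (s D : K -> K) :
  (forall p, p != 0 -> s (pfrac p) != 0) ->
  {morph D : x y / x + y} -> (forall x y, D (x * y) = D x * s y + s x * D y) ->
  (forall c, D (cst c) = 0) -> (forall i j, D (z i j) = 0) ->
  forall x, D x = 0.
Proof.
move=> s0 DD DM DC Dz.
have DP p : D (pfrac p) = 0.
  elim/mpoly_ring_ind: p => [c|u|p q Ep Eq|p q Ep Eq]; first exact: DC.
  - by case/mxvec_indexP: u => i j; rewrite -ZmxE.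
  - by rewrite pfracD DD Ep Eq addr0.
  - by rewrite pfracM DM Ep Eq mul0r mulr0 addr0.
move=> x; have [p [q [q0 Ex]]] := frac_rep x.
have Q0 : pfrac q != 0 by rewrite pfrac_eq0.
have := DM x (pfrac q); rewrite {1}Ex (divfK Q0) !DP mulr0 addr0.
by move/esym/eqP; rewrite mulf_eq0 (negbTE (s0 _ q0)) orbF => /eqP.
Qed.

Lemma pdC i j k l x : pd i j (pd k l x) = pd k l (pd i j x).
Proof.
apply/eqP; rewrite -subr_eq0; apply/eqP.
apply: (@der_eq0 id (fun x => pd i j (pd k l x) - pd k l (pd i j x))).
- by move=> p; rewrite pfrac_eq0.
- by move=> u v; rewrite !pdD opprD addrACA.
- exact: commutator_Leibniz (pdD i j) (pdD k l) (pdM i j) (pdM k l).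
- by move=> c; rewrite !pd_cst ?pd0 subrr.
- by move=> a b; rewrite !pd_z -!cst_nat !pd_cst subrr.
Qed.

(** * Substitutions with nondegenerate Jacobian *)

Section Substitution.
Variable W : 'M[K]_2.

Definition zev : P -> K := mmap (@cst C) (fun m => mxvec W 0 m).
HB.instance Definition _ := GRing.RMorphism.copy zev
  (mmap (@cst C) (fun m => mxvec W 0 m)).

Lemma zevC c : zev c%:MP = cst c.
Proof. exact: mmapC. Qed.

Lemma zevX i j : zev 'X_(mxvec_index i j) = W i j.
Proof. by rewrite /zev mmapX mmap1U mxvecE. Qed.

Lemma pd_zev i j p :
  pd i j (zev p) = \sum_k \sum_l zev p^`M(mxvec_index k l) * pd i j (W k l).
Proof.
elim/mpoly_ring_ind: p => [c|u|p q Ep Eq|p q Ep Eq].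
- rewrite zevC pd_cst big1 // => k _; rewrite big1 // => l _.
  by rewrite mderivC rmorph0 mul0r.
- case/mxvec_indexP: u => a b; rewrite zevX.
  rewrite (bigD1 a) //= (bigD1 b) //= big1 => [|l lb].
    rewrite big1 => [|k ka].
      by rewrite mderivXU eqxx rmorph1 mul1r !addr0.
    rewrite big1 // => l _.
    by rewrite mderivXU mxvec_index_inj eq_sym (negbTE ka) rmorph0 mul0r.
  by rewrite mderivXU mxvec_index_inj andbC eq_sym (negbTE lb) rmorph0 mul0r.
- rewrite rmorphD pdD Ep Eq -big_split; apply: eq_bigr => k _ /=.
  by rewrite -big_split; apply: eq_bigr => l _; rewrite /= mderivD rmorphD mulrDl.
- rewrite rmorphM pdM Ep Eq mulr_suml mulr_sumr -big_split.
  apply: eq_bigr => k _ /=; rewrite mulr_suml mulr_sumr -big_split.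
  apply: eq_bigr => l _; rewrite /= mderivM rmorphD !rmorphM /= mulrDl.
  by congr (_ + _); [exact: mulrAC|rewrite mulrA].
Qed.

(** Injectivity of the transposed Jacobian of Z |-> W, in the form in which the chain rule produces
    it. It keeps denominators from vanishing at W, and thus makes the substitution a field
    morphism. *)
Hypothesis jacobian : forall M : 'M[K]_2,
  (forall i j, \sum_k \sum_l M k l * pd i j (W k l) = 0) -> M = 0.

(* By the chain rule and the Jacobian hypothesis the kernel of [zev] is stable
   under differentiation, so a nonzero element of least degree is constant. *)
Lemma zev_neq0 p : p != 0 -> zev p != 0.
Proof.
have [e] := ubnP (msize p); elim: e p => // e IHe p pe p0.
apply/eqP => evp.
have dp u : p^`M(u) = 0.
  apply/eqP; apply: contraTT isT => dp0.
  have de : (msize p^`M(u) < e)%N by exact: leq_trans (msize_mderiv dp0) pe.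
  have := IHe _ de dp0.
  suff -> : zev p^`M(u) = 0 by rewrite eqxx.
  case/mxvec_indexP: u {dp0 de} => k l.
  have /jacobian/matrixP/(_ k l) : forall i j, \sum_k \sum_l
    (\matrix_(k, l) zev p^`M(mxvec_index k l)) k l * pd i j (W k l) = 0.
    move=> i j; transitivity (pd i j (zev p)); last by rewrite evp pd0.
    rewrite pd_zev.
    by apply: eq_bigr => ? _; apply: eq_bigr => ? _; rewrite mxE.
  by rewrite !mxE.
have pC := mderiv_eq0_const dp; move: evp p0.
by rewrite pC zevC => /eqP; rewrite fmorph_eq0 mpolyC_eq0 => ->.
Qed.

Lemma zsubst_frac p q : q != 0 ->
  zsubst W (pfrac p / pfrac q) = zev p / zev q.
Proof. by move=> q0; apply: zsubstE => // r; apply: zev_neq0. Qed.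

Lemma zsubst_pfrac p : zsubst W (pfrac p) = zev p.
Proof.
rewrite -[pfrac p]divr1 -(rmorph1 (@pfrac C)) zsubst_frac ?oner_eq0 //.
by rewrite rmorph1 divr1.
Qed.

Lemma zsubst_is_additive : {morph zsubst W : x y / x + y}.
Proof.
move=> x y; have [p [q [q0 ->]]] := frac_rep x.
have [r [s [s0 ->]]] := frac_rep y.
rewrite addf_div ?pfrac_eq0 // -!pfracM -pfracD !zsubst_frac ?mulf_neq0 //.
by rewrite !(rmorphD, rmorphM) addf_div ?zev_neq0.
Qed.

Lemma zsubst_is_multiplicative : {morph zsubst W : x y / x * y}.
Proof.
move=> x y; have [p [q [q0 ->]]] := frac_rep x.
have [r [s [s0 ->]]] := frac_rep y.
rewrite mulf_div -!pfracM !zsubst_frac ?mulf_neq0 //.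
by rewrite !rmorphM mulf_div.
Qed.

Lemma zsubst_cst c : zsubst W (cst c) = cst c.
Proof. by rewrite cstE zsubst_pfrac zevC. Qed.

Lemma zsubst_z i j : zsubst W (z i j) = W i j.
Proof. by rewrite ZmxE zsubst_pfrac zevX. Qed.

Lemma zsubst_nmod_morphism : nmod_morphism (zsubst W).
Proof.
by split; [rewrite -(rmorph0 (@cst C)) zsubst_cst|exact: zsubst_is_additive].
Qed.

Lemma zsubst_monoid_morphism : monoid_morphism (zsubst W).
Proof.
split; last exact: zsubst_is_multiplicative.
by rewrite -(rmorph1 (@cst C)) zsubst_cst.
Qed.

(** The chain rule passes from polynomials to fractions: substitute in x q = p, differentiate, and
    cancel the nonzero factor [zev q]. *)
Lemma pd_zsubst i j x :
  pd i j (zsubst W x) = \sum_k \sum_l zsubst W (pd k l x) * pd i j (W k l).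
Proof.
have [p [q [q0 Ex]]] := frac_rep x.
have Q0 : pfrac q != 0 by rewrite pfrac_eq0.
have E0 : zev q != 0 by exact: zev_neq0.
have Exq : x * pfrac q = pfrac p by rewrite Ex (divfK Q0).
have Eq := congr1 (zsubst W) Exq.
rewrite zsubst_is_multiplicative !zsubst_pfrac in Eq.
have := congr1 (pd i j) Eq; rewrite pdM !pd_zev.
move/(canRL (addrK _)) => E; apply: (mulIf E0); rewrite E mulr_suml mulr_sumr.
rewrite -sumrB; apply: eq_bigr => k _.
rewrite mulr_suml mulr_sumr -sumrB; apply: eq_bigr => l _.
have := congr1 (zsubst W) (congr1 (pd k l) Exq).
rewrite pdM zsubst_is_additive zsubst_is_multiplicative (zsubst_is_multiplicative x).
rewrite !pd_pfrac !zsubst_pfrac.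
move=> <-; exact: chain_rule_cancel.
Qed.

End Substitution.
End Calculus.

(** * Operators on tensor-valued functions *)

Section DifferentialOperators.
Variables (K : comNzRingType) (n : nat).
Variables (z : 'I_2 -> 'I_2 -> K) (d : 'I_2 -> 'I_2 -> {additive K -> K}).
Hypothesis dM : forall i j x y, d i j (x * y) = d i j x * y + x * d i j y.
Hypothesis dz : forall i j k l, d i j (z k l) = ((i == k) && (j == l))%:R.
Hypothesis dC : forall i j k l x, d i j (d k l x) = d k l (d i j x).
Local Notation idx := {ffun 'I_n -> 'I_2}.
Local Notation T := {ffun idx -> K}.
Implicit Types (f g : T) (I : idx) (k l : 'I_n) (a b c e i j : 'I_2).

(* In terms of auxiliary variables x_a (rows of Z) and y_a (columns of Z and
   tensor slots), [shiftop a b] is d/dx_a d/dy_b, [rowop b c] is x_b d/dx_c,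
   [colop a e] is y_a d/dy_e and [raiseop a b] is y_a x_b. *)
Definition shiftop a b f : T := [ffun I => d a b (f I)].
Definition rowop b c f : T := [ffun I => \sum_e z b e * d c e (f I)].
Definition colop a e f : T :=
  [ffun I => \sum_c z c a * d c e (f I) + \sum_(k | I k == a) f (put I k e)].
Definition raiseop a b f : T :=
  [ffun I => \sum_c z c a * (\sum_e z b e * d c e (f I)) + z b a * f I
             + \sum_(k | I k == a) \sum_e z b e * f (put I k e)].
Definition euler f := rowop 0 0 f + rowop 1 1 f.

(** For each row index c this is one of the two equations of [nabla_plus] in slot k, without the
    factor 2: the column index of a derivative and the slot index are interchangeable. *)
Definition regular f := forall k I c,
  d c 1 (f (put I k 0)) = d c 0 (f (put I k 1)).
Definition symmetric_tensor f :=
  forall (s : 'S_n) I, f [ffun k => I (s k)] = f I.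

Lemma ord2P i : {i = 0} + {i = 1}.
Proof. by case: i => [[|[|m]] Hm]; [left|right|]; try exact: val_inj. Qed.

Lemma sum_ord2 (V : nmodType) (F : 'I_2 -> V) : \sum_i F i = F 0 + F 1.
Proof.
by rewrite !big_ord_recl big_ord0 addr0; congr (_ + F _); apply: val_inj.
Qed.

Lemma put_id I k : put I k (I k) = I.
Proof. by apply/ffunP => l; rewrite ffunE; case: eqP => // ->. Qed.

Lemma putE I k j l : put I k j l = if l == k then j else I l.
Proof. by rewrite ffunE. Qed.

Lemma put_put I k i j : put (put I k i) k j = put I k j.
Proof. by apply/ffunP => l; rewrite !ffunE; case: eqP. Qed.

Lemma put_comm I k l i j : k != l -> put (put I k i) l j = put (put I l j) k i.
Proof.
move=> kl; apply/ffunP => m; rewrite !ffunE.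
by case: (m =P k) => // ->; rewrite (negbTE kl).
Qed.

Lemma regularE f : regular f -> forall k I c i j,
  d c i (f (put I k j)) = d c j (f (put I k i)).
Proof.
by move=> Rf k I c i j; case: (ord2P i) => ->; case: (ord2P j) => ->.
Qed.

Lemma regular_intro f :
  (forall k I c i j, d c i (f (put I k j)) = d c j (f (put I k i))) ->
  regular f.
Proof. by move=> Rf k I c; apply: Rf. Qed.

Lemma d_row c i b (g : 'I_2 -> K) :
  d c i (\sum_e z b e * g e) = (c == b)%:R * g i + \sum_e z b e * d c i (g e).
Proof.
rewrite raddf_sum /= (eq_bigr _ (fun e _ => dM c i _ _)) big_split /=.
congr (_ + _); rewrite (bigD1 i) //= dz eqxx andbT big1 ?addr0 // => e ei.
by rewrite dz [i == e]eq_sym (negbTE ei) andbF mul0r.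
Qed.

Lemma d_col c i a (g : 'I_2 -> K) :
  d c i (\sum_b z b a * g b) = (i == a)%:R * g c + \sum_b z b a * d c i (g b).
Proof.
rewrite raddf_sum /= (eq_bigr _ (fun e _ => dM c i _ _)) big_split /=.
congr (_ + _); rewrite (bigD1 c) //= dz eqxx /= big1 ?addr0 // => e ei.
by rewrite dz [c == e]eq_sym (negbTE ei) mul0r.
Qed.

Lemma d_nat c i m : d c i m%:R = 0.
Proof.
suff d1 : d c i 1 = 0 by rewrite raddfMn /= d1 mul0rn.
by have := dM c i 1 1; rewrite !mulr1 mul1r -[LHS]addr0 => /addrI.
Qed.

Lemma sum_delta (g : 'I_2 -> K) b x :
  \sum_i g i * ((i == b)%:R * x) = g b * x.
Proof.
rewrite (bigD1 b) //= eqxx mul1r big1 ?addr0 // => i ib.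
by rewrite (negbTE ib) mul0r mulr0.
Qed.

Lemma sum_put I k j a (Q : 'I_n -> K) :
  \sum_(l | put I k j l == a) Q l
  = (j == a)%:R * Q k + \sum_(l | (l != k) && (I l == a)) Q l.
Proof.
rewrite (bigID (pred1 k)) /=; congr (_ + _); last first.
  by apply: eq_bigl => l; rewrite putE andbC; case: (l == k).
case: (j =P a) => [ja|/eqP ja]; rewrite ?mul1r ?mul0r.
  rewrite (big_pred1 k) // => l; rewrite /= putE.
  by case: (l == k); rewrite ?ja ?eqxx ?andbF.
rewrite big1 // => l /andP[la /eqP lk]; move: la.
by rewrite lk putE eqxx (negbTE ja).
Qed.

(** The difference of the two sides is, up to sign, 0 or the determinant of the derivatives. Pick a
    slot k: as there are only two indices, distinct b and e include [I k]. Regularity turns the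
    other derivative of f_I into one with column index [I k] of another component, after which both
    derivatives have the same column and the row indices can be exchanged. *)
Lemma harmonic f : (0 < n)%N -> regular f -> forall I a b c e,
  d a b (d c e (f I)) = d a e (d c b (f I)).
Proof.
move=> n0 /regularE Rf I a b c e; pose k := Ordinal n0.
have H i j : I k = i -> d a i (d c j (f I)) = d a j (d c i (f I)).
  move=> <-; have E u : d u j (f I) = d u (I k) (f (put I k j)).
    by rewrite Rf put_id.
  by rewrite E [RHS]dC E dC.
case: (b =P e) => [-> //|be].
case: (I k =P b) => [/H -> //|Ib]; case: (I k =P e) => [/H -> //|Ie].
move: be Ib Ie; case: (ord2P b) => ->; case: (ord2P e) => ->;
  by case: (ord2P (I k)) => ->.
Qed.

(** * Stability of regular and of symmetric tensors *)

Lemma regular_shift a b f : regular f -> regular (shiftop a b f).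
Proof.
move=> Rf; apply: regular_intro => k I c i j; rewrite !ffunE.
by rewrite dC (regularE Rf) dC.
Qed.

Lemma regular_row a b f : regular f -> regular (rowop a b f).
Proof.
move=> /regularE Rf; apply: regular_intro => k I c i j; rewrite !ffunE !d_row Rf.
by congr (_ + _); apply: eq_bigr => e _; rewrite dC Rf dC.
Qed.

(** Differentiating the coordinate contributes a term for u = a, slot [k] contributes one for v = a;
    regularity gives the latter the shape that makes the two trade places when u and v do. This is
    why [colop] must carry the sum over the slots. *)
Lemma regular_col a b f : regular f -> regular (colop a b f).
Proof.
move=> /regularE Rf; apply: regular_intro => k I c i j.
have E u v : d c u (colop a b f (put I k v)) =
  ((u == a)%:R * d c b (f (put I k v)) + (v == a)%:R * d c b (f (put I k u)))
  + (\sum_e z e a * d e b (d c u (f (put I k v)))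
     + \sum_(l | (l != k) && (I l == a)) d c u (f (put (put I l b) k v))).
  rewrite ffunE raddfD /= d_col sum_put raddfD dM.
  rewrite d_nat.
  rewrite mul0r add0r put_put (Rf k I c u b) raddf_sum -!addrA; congr (_ + _).
  rewrite addrCA; congr (_ + (_ + _)).
    by apply: eq_bigr => e _; rewrite dC.
  by apply: eq_bigr => l /andP[lk _]; rewrite put_comm // eq_sym.
rewrite !E; congr (_ + _); first by rewrite addrC.
congr (_ + _); apply: eq_bigr => l _; first by rewrite Rf.
by rewrite Rf.
Qed.

Lemma put_perm (s : 'S_n) I k j :
  put [ffun l => I (s l)] k j = [ffun l => put I (s k) j (s l)].
Proof. by apply/ffunP => l; rewrite !ffunE (inj_eq perm_inj). Qed.

Lemma symmetric_tensor_put f I k l i j : symmetric_tensor f -> k != l ->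
  f (put (put I k i) l j) = f (put (put I k j) l i).
Proof.
move=> Sf kl; rewrite -(Sf (tperm k l)); congr (f _); apply/ffunP => m.
rewrite !ffunE; case: tpermP => [->|->|/eqP mk /eqP ml].
- by rewrite !eqxx (negbTE kl).
- by rewrite !eqxx (negbTE kl).
- by rewrite (negbTE mk) (negbTE ml).
Qed.

Lemma sum_perm (s : 'S_n) (A : pred 'I_n) (F : 'I_n -> K) :
  \sum_(k | A (s k)) F (s k) = \sum_(k | A k) F k.
Proof. by rewrite [RHS](reindex_inj (@perm_inj _ s)). Qed.

Lemma symmetric_tensor_shift a b f :
  symmetric_tensor f -> symmetric_tensor (shiftop a b f).
Proof. by move=> Sf s I; rewrite !ffunE Sf. Qed.

Lemma symmetric_tensor_row a b f : symmetric_tensor f -> symmetric_tensor (rowop a b f).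
Proof. by move=> Sf s I; rewrite !ffunE Sf. Qed.

Lemma symmetric_tensor_col a b f : symmetric_tensor f -> symmetric_tensor (colop a b f).
Proof.
move=> Sf s I; rewrite !ffunE Sf; congr (_ + _).
rewrite -[RHS](sum_perm s (fun k => I k == a)).
by apply: eq_big => [k|k _]; rewrite ?ffunE // put_perm Sf.
Qed.

Lemma symmetric_tensor_raise a b f :
  symmetric_tensor f -> symmetric_tensor (raiseop a b f).
Proof.
move=> Sf s I; rewrite !ffunE Sf; congr (_ + _).
rewrite -[RHS](sum_perm s (fun k => I k == a)).
apply: eq_big => [k|k _]; first by rewrite ffunE.
by apply: eq_bigr => e _; rewrite put_perm Sf.
Qed.

(** The bookkeeping is that of [regular_col], with extra terms from differentiating the row
    coordinate. In [f (put (put I l u) k v)] the two indices sit in different slots and no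
    derivative is left: exchanging them takes the symmetry of the tensor instead of regularity. *)
Lemma regular_raise a b f :
  symmetric_tensor f -> regular f -> regular (raiseop a b f).
Proof.
move=> Sf /regularE Rf; apply: regular_intro => k I c i j.
have E u v : d c u (raiseop a b f (put I k v)) =
  ((u == a)%:R * (\sum_e z b e * d c e (f (put I k v)))
   + (v == a)%:R * (\sum_e z b e * d c e (f (put I k u))))
  + (c == b)%:R * ((u == a)%:R * f (put I k v) + (v == a)%:R * f (put I k u))
  + (\sum_x z x a * ((c == b)%:R * d x u (f (put I k v))
                     + \sum_e z b e * d x e (d c u (f (put I k v))))
     + z b a * d c u (f (put I k v)))
  + \sum_(l | (l != k) && (I l == a))
      ((c == b)%:R * f (put (put I l u) k v)
       + \sum_e z b e * d c u (f (put (put I l e) k v))).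
  rewrite ffunE !raddfD /= d_col sum_put raddfD.
  rewrite !dM d_nat dz mul0r add0r.
  rewrite [d c u (\sum_(l | (l != k) && _) _)]raddf_sum /=.
  have -> : \sum_x z x a * d c u (\sum_e z b e * d x e (f (put I k v))) =
     \sum_x z x a * ((c == b)%:R * d x u (f (put I k v))
                     + \sum_e z b e * d x e (d c u (f (put I k v)))).
    apply: eq_bigr => x _; rewrite d_row; congr (_ * (_ + _)).
    by apply: eq_bigr => e _; rewrite dC.
  have -> : d c u (\sum_e z b e * f (put (put I k v) k e)) =
      (c == b)%:R * f (put I k u) + \sum_e z b e * d c e (f (put I k u)).
    rewrite d_row put_put; congr (_ + _); apply: eq_bigr => e _.
    by rewrite put_put (Rf k I c u e).
  have -> : \sum_(l | (l != k) && (I l == a))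
       d c u (\sum_e z b e * f (put (put I k v) l e)) =
    \sum_(l | (l != k) && (I l == a))
      ((c == b)%:R * f (put (put I l u) k v)
       + \sum_e z b e * d c u (f (put (put I l e) k v))).
    apply: eq_bigr => l /andP[lk _]; rewrite d_row put_comm 1?eq_sym //.
    congr (_ + _); apply: eq_bigr => e _; rewrite put_comm 1?eq_sym //.
  by rewrite -mulnb natrM; ring.
rewrite !E; congr (_ + _ + _ + _).
- by rewrite addrC.
- by rewrite addrC.
- rewrite Rf; congr (_ + _); apply: eq_bigr => x _.
  by rewrite (Rf k I x i j).
- apply: eq_bigr => l /andP[lk _]; rewrite symmetric_tensor_put //; congr (_ + _).
  by apply: eq_bigr => e _; rewrite Rf.
Qed.

(** In the auxiliary variables both sides are y_a x_b d/dx_c d/dy_e. The second-order terms agree by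
    harmonicity and the slot terms by regularity; the first-order term with z_ba comes from [rowop]
    differentiating the coordinate in [colop]. *)
Lemma raise_shift a b c e f : (0 < n)%N -> regular f ->
  raiseop a b (shiftop c e f) = rowop b c (colop a e f).
Proof.
move=> n0 Rf; apply/ffunP => I; rewrite !ffunE.
transitivity (\sum_i z b i * ((i == a)%:R * d c e (f I)
     + \sum_x z x a * d c i (d x e (f I)) + \sum_(k | I k == a) d c i (f (put I k e)))).
  under [RHS]eq_bigr => i _ do rewrite 2!mulrDr.
  rewrite 2!big_split /=; congr (_ + _); first (rewrite addrC; congr (_ + _)).
  - apply: esym; under eq_bigr => x _ do rewrite mulr_sumr.
    rewrite exchange_big /=; apply: eq_bigr => i _.
    rewrite mulr_sumr; apply: eq_bigr => x _.
    by rewrite mulrCA (harmonic n0 Rf) dC.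
  - rewrite (bigD1 a) //=. rewrite eqxx mul1r big1 ?addr0 // => i ia.
    by rewrite (negbTE ia) mul0r mulr0.
  under [RHS]eq_bigr => i _ do rewrite mulr_sumr.
  rewrite [RHS]exchange_big /=; apply: eq_bigr => k _.
  by apply: eq_bigr => i _; rewrite [shiftop _ _ _ _]ffunE (regularE Rf).
by apply: eq_bigr => i _; rewrite raddfD /= d_col raddf_sum.
Qed.

(** The commutator of x_b d/dx_b with x_b d/dx_a, written without subtraction: the weight of row b
    goes up by one. The next lemma is the matching loss in row a. *)
Lemma row_row a b f : a != b ->
  rowop b b (rowop b a f) = rowop b a f + rowop b a (rowop b b f).
Proof.
move=> ab; apply/ffunP => I; rewrite !ffunE.
under eq_bigr => e _ do rewrite d_row eqxx mul1r mulrDr mulr_sumr.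
rewrite big_split /=; congr (_ + _); rewrite exchange_big /=.
apply: eq_bigr => e _; rewrite d_row (negbTE ab) mul0r add0r mulr_sumr.
by apply: eq_bigr => x _; rewrite mulrCA dC.
Qed.

Lemma row_row_r a b f : a != b ->
  rowop a a (rowop b a f) + rowop b a f = rowop b a (rowop a a f).
Proof.
move=> ab; apply/ffunP => I; rewrite !ffunE.
under [RHS]eq_bigr => e _ do rewrite d_row eqxx mul1r mulrDr mulr_sumr.
rewrite [RHS]big_split /= [RHS]addrC; congr (_ + _); rewrite exchange_big /=.
apply: eq_bigr => e _; rewrite d_row (negbTE ab) mul0r add0r mulr_sumr.
by apply: eq_bigr => x _; rewrite mulrCA dC.
Qed.

Lemma row_rowC a b f : rowop a a (rowop b b f) = rowop b b (rowop a a f).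
Proof.
case: (a =P b) => [-> //|/eqP ab]; apply/ffunP => I; rewrite !ffunE.
under eq_bigr => e _ do
  rewrite d_row (negbTE ab) mul0r add0r mulr_sumr.
rewrite exchange_big /=; apply: eq_bigr => e _.
rewrite d_row eq_sym (negbTE ab) mul0r add0r mulr_sumr.
by apply: eq_bigr => x _; rewrite mulrCA dC.
Qed.

Lemma row_colC a b c e f : rowop b c (colop a e f) = colop a e (rowop b c f).
Proof.
apply/ffunP => I; rewrite !ffunE.
transitivity (\sum_i z b i * ((i == a)%:R * d c e (f I)
     + \sum_x z x a * d c i (d x e (f I)) + \sum_(k | I k == a) d c i (f (put I k e)))).
  by apply: eq_bigr => i _; rewrite raddfD /= d_col raddf_sum.
under eq_bigr => i _ do rewrite 2!mulrDr.
rewrite 2!big_split /=; congr (_ + _); last first.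
  under eq_bigr => i _ do rewrite mulr_sumr.
  rewrite exchange_big /=; apply: eq_bigr => k _.
  by rewrite [RHS]ffunE.
under [RHS]eq_bigr => x _ do rewrite d_row mulrDr mulr_sumr.
rewrite big_split /= !sum_delta; congr (_ + _).
under eq_bigr => i _ do rewrite mulr_sumr.
rewrite exchange_big /=; apply: eq_bigr => x _; apply: eq_bigr => i _.
by rewrite mulrCA dC.
Qed.

Definition slots I a : nat := #|[pred k | I k == a]|.

Lemma colop_diag a f I :
  colop a a f I = \sum_c z c a * d c a (f I) + (slots I a)%:R * f I.
Proof.
rewrite ffunE; congr (_ + _); rewrite /slots -sum1_card natr_sum mulr_suml.
by apply: eq_bigr => k /eqP <-; rewrite put_id mul1r.
Qed.

Lemma slots_put a b I k : a != b -> I k = a ->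
  slots (put I k b) b = (slots I b).+1.
Proof.
move=> ab Ik; rewrite /slots (cardD1 k) inE putE eqxx eqxx add1n; congr _.+1.
apply: eq_card => l; rewrite !inE putE.
by case: (l =P k) => // ->; rewrite Ik (negbTE ab).
Qed.

Lemma slots_put_from a b I k : a != b -> I k = a ->
  (slots (put I k b) a).+1 = slots I a.
Proof.
move=> ab Ik; rewrite /slots [RHS](cardD1 k) inE Ik eqxx add1n; congr _.+1.
apply: eq_card => l; rewrite !inE putE.
by case: (l =P k) => // _; rewrite eq_sym (negbTE ab).
Qed.

Lemma slotsD I a b : a != b -> (slots I a + slots I b = n)%N.
Proof.
move=> ab; rewrite -[RHS](card_ord n) -(cardC [pred k | I k == a]).
congr addn; apply: eq_card => k; rewrite !inE; move: ab.
by case: (ord2P a) => ->; case: (ord2P b) => ->; case: (ord2P (I k)) => ->.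
Qed.

Lemma slots_le I a : (slots I a <= n)%N.
Proof. by rewrite -[X in (_ <= X)%N](card_ord n) max_card. Qed.

(** The operator y_a d/dy_b lowers the weight of column b by one. In the slot part the unit appears
    because [put I k b] contains one more b than [I]. *)
Lemma col_col a b f : a != b ->
  colop b b (colop a b f) + colop a b f = colop a b (colop b b f).
Proof.
move=> ab; apply/ffunP => I; rewrite ffunE colop_diag.
have E : colop a b f I = \sum_c z c a * d c b (f I)
   + \sum_(k | I k == a) f (put I k b) by rewrite ffunE.
have -> : colop a b (colop b b f) I =
  \sum_c z c a * d c b (f I)
  + \sum_c z c b * (\sum_x z x a * d c b (d x b (f I)))
  + (slots I b)%:R * (\sum_c z c a * d c b (f I))
  + (\sum_c z c b * (\sum_(k | I k == a) d c b (f (put I k b)))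
     + (slots I b)%:R * (\sum_(k | I k == a) f (put I k b))
     + \sum_(k | I k == a) f (put I k b)).
  rewrite ffunE; congr (_ + _).
    under eq_bigr => c _.
      rewrite colop_diag raddfD /= d_col dM d_nat mul0r add0r eqxx mul1r 2!mulrDr.
      over.
    rewrite 2!big_split /=; congr (_ + _ + _); last first.
      by rewrite mulr_sumr; apply: eq_bigr => c _; rewrite mulrCA.
    under eq_bigr => c _ do rewrite mulr_sumr.
    under [RHS]eq_bigr => c _ do rewrite mulr_sumr.
    rewrite exchange_big /=; apply: eq_bigr => c _; apply: eq_bigr => x _.
    by rewrite mulrCA dC.
  under [X in _ = X + _ + _]eq_bigr => c _ do rewrite mulr_sumr.
  rewrite exchange_big mulr_sumr -!big_split /=.
  apply: eq_bigr => k /eqP Ik; rewrite colop_diag (slots_put ab Ik) mulrS.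
  by rewrite mulrDl mul1r addrA addrAC.
have -> : \sum_c z c b * d c b (colop a b f I) =
  \sum_c z c b * (\sum_x z x a * d c b (d x b (f I)))
  + \sum_c z c b * (\sum_(k | I k == a) d c b (f (put I k b))).
  rewrite -big_split /=; apply: eq_bigr => c _; rewrite -mulrDr E.
  by rewrite raddfD /= d_col eq_sym (negbTE ab) mul0r add0r raddf_sum.
by rewrite E; ring.
Qed.

Lemma eulerE f I : euler f I = \sum_a \sum_e z a e * d a e (f I).
Proof. by rewrite !ffunE [RHS]sum_ord2. Qed.

(** The column weights count, besides the degree, each of the [n] slots exactly once. *)
Lemma euler_diag f : colop 0 0 f + colop 1 1 f = euler f + f *+ n.
Proof.
apply/ffunP => I; rewrite [LHS]ffunE [RHS]ffunE ffunMnE.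
rewrite !colop_diag eulerE -[_ *+ n]mulr_natl.
have /(congr1 (GRing.natmul (1 : K))) <- := slotsD I (isT : (0 : 'I_2) != 1).
by rewrite natrD !sum_ord2; ring.
Qed.

Lemma euler_shift a b f :
  euler (shiftop a b f) + shiftop a b f = shiftop a b (euler f).
Proof.
apply/ffunP => I; rewrite ffunE eulerE [RHS]ffunE eulerE !ffunE raddf_sum /=.
under [RHS]eq_bigr => c _ do rewrite d_row.
rewrite big_split /= [RHS]addrC; congr (_ + _).
  by apply: eq_bigr => c _; apply: eq_bigr => e _; rewrite dC.
rewrite (bigD1 a) //= eqxx mul1r big1 ?addr0 // => i ia.
by rewrite eq_sym (negbTE ia) mul0r.
Qed.

Lemma rowopD a b f g : rowop a b (f + g) = rowop a b f + rowop a b g.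
Proof.
apply/ffunP => I; rewrite !ffunE -big_split /=.
by apply: eq_bigr => e _; rewrite raddfD mulrDr.
Qed.

Lemma shiftopD a b f g : shiftop a b (f + g) = shiftop a b f + shiftop a b g.
Proof. by apply/ffunP => I; rewrite !ffunE raddfD. Qed.

Lemma colopD a b f g : colop a b (f + g) = colop a b f + colop a b g.
Proof.
apply/ffunP => I; rewrite !ffunE addrACA -!big_split /=.
congr (_ + _); apply: eq_bigr => e _; first by rewrite raddfD mulrDr.
by rewrite ffunE.
Qed.

Definition scl (x : K) f : T := [ffun I => x * f I].

Section Constant.
Variable x : K.
Hypothesis dx : forall a b, d a b x = 0.

Lemma d_constM a b y : d a b (x * y) = x * d a b y.
Proof. by rewrite dM dx mul0r add0r. Qed.

Lemma rowopZ a b f : rowop a b (scl x f) = scl x (rowop a b f).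
Proof.
apply/ffunP => I; rewrite !ffunE mulr_sumr.
by apply: eq_bigr => e _; rewrite d_constM mulrCA.
Qed.

Lemma colopZ a b f : colop a b (scl x f) = scl x (colop a b f).
Proof.
apply/ffunP => I; rewrite !ffunE mulrDr !mulr_sumr; congr (_ + _).
  by apply: eq_bigr => e _; rewrite d_constM mulrCA.
by apply: eq_bigr => k _; rewrite ffunE.
Qed.

Lemma regularZ f : regular f -> regular (scl x f).
Proof. by move=> Rf k I c; rewrite !ffunE !d_constM Rf. Qed.

End Constant.

Lemma regularD f g : regular f -> regular g -> regular (f + g).
Proof. by move=> Rf Rg k I c; rewrite !ffunE !raddfD /= Rf Rg. Qed.

Lemma regular0 : regular 0.
Proof. by move=> k I c; rewrite !ffunE !raddf0. Qed.

Lemma symmetric_tensorD f g :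
  symmetric_tensor f -> symmetric_tensor g -> symmetric_tensor (f + g).
Proof. by move=> Sf Sg s I; rewrite !ffunE Sf Sg. Qed.

Lemma symmetric_tensorZ x f : symmetric_tensor f -> symmetric_tensor (scl x f).
Proof. by move=> Sf s I; rewrite !ffunE Sf. Qed.

End DifferentialOperators.

(** The operator N - E kills the component of eigenvalue N and multiplies the one of eigenvalue i by
    N - i, so induction on N applies to the scaled components; closure of [Q] under division removes
    the factors. *)
Lemma eigencomponents (V : zmodType) (E : V -> V) (Q : V -> Prop) :
  {morph E : x y / x + y} -> Q 0 -> (forall x y, Q x -> Q y -> Q (x - y)) ->
  (forall x m, Q (x *+ m.+1) -> Q x) -> (forall x, Q x -> Q (E x)) ->
  forall N (g : nat -> V), (forall m, E (g m) = g m *+ m) ->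
  Q (\sum_(m < N) g m) -> forall m, (m < N)%N -> Q (g m).
Proof.
move=> ED Q0 QB Qdiv QE; have E0 : E 0 = 0.
  by apply: (addrI (E 0)); rewrite -ED !addr0.
have En x m : E (x *+ m) = E x *+ m.
  by elim: m => [|m IHm]; rewrite ?mulr0n // !mulrS ED IHm.
have QN x : Q x -> Q (- x) by move=> Qx; rewrite -sub0r; apply: QB.
have QD x y : Q x -> Q y -> Q (x + y).
  by move=> Qx Qy; rewrite -[y]opprK; apply: QB (QN _ Qy).
have Qn x m : Q x -> Q (x *+ m).
  by move=> Qx; elim: m => [|m IHm]; rewrite ?mulr0n // mulrS; apply: QD.
elim=> // N IHN g Eg Qg m.
have Qlt i : (i < N)%N -> Q (g i).
  move=> iN; have : Q (g i *+ (N - i)).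
    apply: (IHN (fun i => g i *+ (N - i))) iN => [j|].
      by rewrite En Eg mulrnAC.
    have : Q ((\sum_(i < N.+1) g i) *+ N - E (\sum_(i < N.+1) g i)).
      by apply: QB; [apply: Qn|apply: QE].
    congr Q; rewrite (big_morph E ED E0) -sumrMnl -sumrB big_ord_recr /= Eg.
    rewrite subrr addr0; apply: eq_bigr => j _.
    by rewrite Eg mulrnBr // ltnW.
  by rewrite -(prednK (_ : (0 < N - i)%N)) ?subn_gt0 //; apply: Qdiv.
rewrite ltnS leq_eqVlt => /orP[/eqP ->|/Qlt //].
move: Qg; rewrite big_ord_recr /= => Qg.
rewrite -[g N](addKr (\sum_(i < N) g i)) addrC; apply: QB => //.
by apply: (big_ind Q) => // i _; apply: Qlt.
Qed.

(** * Submodules of the space of regular polynomials *)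

Section Irreducibility.
Variables (k0 : numFieldType) (K : fieldType) (iota : {rmorphism k0 -> K}).
Variable n : nat.
Hypothesis n_gt0 : (0 < n)%N.
Variables (z : 'I_2 -> 'I_2 -> K) (d : 'I_2 -> 'I_2 -> {additive K -> K}).
Hypothesis dM : forall i j x y, d i j (x * y) = d i j x * y + x * d i j y.
Hypothesis dz : forall i j k l, d i j (z k l) = ((i == k) && (j == l))%:R.
Hypothesis dC : forall i j k l x, d i j (d k l x) = d k l (d i j x).
Hypothesis d_iota : forall c i j, d i j (iota c) = 0.

Variable pol : K -> Prop.
Hypothesis pol_iota : forall c, pol (iota c).
Hypothesis polD : forall x y, pol x -> pol y -> pol (x + y).
Hypothesis polM : forall x y, pol x -> pol y -> pol (x * y).
Hypothesis pol_z : forall i j, pol (z i j).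
Hypothesis pol_d : forall i j x, pol x -> pol (d i j x).
(** The predicate [A] selects the variables whose degree is counted; it is used for one row, one
    column and all four variables. *)
Hypothesis pol_homog : forall (A : pred ('I_2 * 'I_2)) x, pol x ->
  exists N (g : nat -> K), x = \sum_(m < N) g m /\
    forall m, \sum_i \sum_(j | A (i, j)) z i j * d i j (g m) = g m *+ m.
Hypothesis pol_const : forall x, pol x ->
  \sum_i \sum_j z i j * d i j x = 0 -> exists c, x = iota c.

Local Notation idx := {ffun 'I_n -> 'I_2}.
Local Notation T := {ffun idx -> K}.
Local Notation S := (@shiftop K n d).
Local Notation R := (@rowop K n z d).
Local Notation L := (@colop K n z d).
Local Notation C := (@raiseop K n z d).
Local Notation E := (@euler K n z d).
Implicit Types (f g : T) (I : idx) (c : k0) (a b e : 'I_2) (Q U : T -> Prop).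

Definition polyregular f :=
  [/\ symmetric_tensor f, forall I, pol (f I) & regular d f].
Local Notation F := polyregular.

Lemma pol_sum J (r : seq J) (A : pred J) (G : J -> K) :
  (forall j, A j -> pol (G j)) -> pol (\sum_(j <- r | A j) G j).
Proof.
by move=> PG; apply: big_ind => //; rewrite -(rmorph0 iota).
Qed.

Lemma polyregular_shift a b f : F f -> F (S a b f).
Proof.
move=> [Sf Pf Rf]; split; [exact: symmetric_tensor_shift| |exact: regular_shift].
by move=> I; rewrite ffunE; apply: pol_d.
Qed.

Lemma polyregular_row a b f : F f -> F (R a b f).
Proof.
move=> [Sf Pf Rf]; split; [exact: symmetric_tensor_row| |exact: regular_row].
by move=> I; rewrite ffunE; apply: pol_sum => e _; apply: polM => //; apply: pol_d.
Qed.

Lemma polyregular_col a b f : F f -> F (L a b f).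
Proof.
move=> [Sf Pf Rf]; split; [exact: symmetric_tensor_col| |exact: regular_col].
move=> I; rewrite ffunE; apply: polD; apply: pol_sum => e _ //.
by apply: polM => //; apply: pol_d.
Qed.

Lemma polyregular_raise a b f : F f -> F (C a b f).
Proof.
move=> [Sf Pf Rf]; split; [exact: symmetric_tensor_raise| |exact: regular_raise].
move=> I; rewrite ffunE; apply: polD; last first.
  by apply: pol_sum => k _; apply: pol_sum => e _; apply: polM.
apply: polD; last exact: polM.
apply: pol_sum => x _; apply: polM => //.
by apply: pol_sum => e _; apply: polM => //; apply: pol_d.
Qed.

Lemma polyregular0 : F 0.
Proof.
split; [by move=> s I; rewrite !ffunE| |exact: regular0].
by move=> I; rewrite ffunE -(rmorph0 iota).
Qed.

Lemma polyregularD f g : F f -> F g -> F (f + g).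
Proof.
move=> [Sf Pf Rf] [Sg Pg Rg]; split; [exact: symmetric_tensorD| |exact: regularD].
by move=> I; rewrite ffunE; apply: polD.
Qed.

Lemma polyregularZ c f : F f -> F (scl (iota c) f).
Proof.
move=> [Sf Pf Rf]; split; [exact: symmetric_tensorZ| |exact: regularZ].
by move=> I; rewrite ffunE; apply: polM.
Qed.

Definition linear_space Q :=
  [/\ Q 0, forall f g, Q f -> Q g -> Q (f + g)
    & forall c f, Q f -> Q (scl (iota c) f)].

Lemma linear_space_polyregular : linear_space F.
Proof. by split; [exact: polyregular0|exact: polyregularD|exact: polyregularZ]. Qed.

Lemma scl_nat m f : scl (iota m%:R) f = f *+ m.
Proof. by apply/ffunP => I; rewrite ffunE ffunMnE rmorph_nat mulr_natl. Qed.

Lemma sclA x y f : scl x (scl y f) = scl (x * y) f.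
Proof. by apply/ffunP => I; rewrite !ffunE mulrA. Qed.

Lemma scl1 f : scl 1 f = f.
Proof. by apply/ffunP => I; rewrite !ffunE mul1r. Qed.

Section LinearSpace.
Variable Q : T -> Prop.
Hypothesis linQ : linear_space Q.

Lemma linN f : Q f -> Q (- f).
Proof.
have [_ _ QZ] := linQ; move/(QZ (- 1)); congr Q.
by apply/ffunP => I; rewrite !ffunE rmorphN1 mulN1r.
Qed.

Lemma linB f g : Q f -> Q g -> Q (f - g).
Proof. by have [_ QD _] := linQ; move=> Qf Qg; apply: QD (linN Qg). Qed.

Lemma lin_div f m : Q (f *+ m.+1) -> Q f.
Proof.
have [_ _ QZ] := linQ; move/(QZ m.+1%:R^-1); rewrite -scl_nat sclA -rmorphM.
by rewrite mulVf ?pnatr_eq0 // rmorph1 scl1.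
Qed.

Lemma linMn f m : Q f -> Q (f *+ m).
Proof. by have [_ _ QZ] := linQ; rewrite -scl_nat; apply: QZ. Qed.

Lemma lin_cancel f g m : Q g -> Q (g + f *+ m.+1) -> Q f.
Proof.
by move=> Qg Qgf; apply: (@lin_div _ m); rewrite -[f *+ _](addKr g) addrC; apply: linB.
Qed.

End LinearSpace.

(** * Weight decompositions of regular polynomials *)

Definition decomposable (X : T -> T) := forall f, F f ->
  exists N (g : nat -> T), f = \sum_(m < N) g m /\ forall m, X (g m) = g m *+ m.

(** An eigenvalue on component [I] is a degree plus the offset [w I], so the m-th eigencomponent
    collects from each component the part of degree m - w I. *)
Lemma decomposable_weight (A : pred ('I_2 * 'I_2)) (w : idx -> nat) (X : T -> T) :
  (forall f I, X f I =
     \sum_i \sum_(j | A (i, j)) z i j * d i j (f I) + (w I)%:R * f I) ->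
  decomposable X.
Proof.
move=> XE f [_ Pf _].
have /fin_all_exists[N] : forall I, exists M, exists g : nat -> K,
  f I = \sum_(m < M) g m /\
    forall m, \sum_i \sum_(j | A (i, j)) z i j * d i j (g m) = g m *+ m.
  by move=> I; apply: pol_homog.
move=> /fin_all_exists[g fg].
(* The test [w I <= m] prevents truncated subtraction from reusing degree 0 for smaller m. *)
pose h m := [ffun I => if (w I <= m < w I + N I)%N then g I (m - w I)%N else 0] : T.
exists (\max_I (w I + N I))%N, h; split => [|m].
  apply/ffunP => I; rewrite sum_ffunE (fg I).1.
  under [RHS]eq_bigr => m _ do rewrite ffunE.
  rewrite -[RHS](big_mkord predT (fun m =>
    if (w I <= m < w I + N I)%N then g I (m - w I)%N else 0)) /=.
  have le : (w I + N I <= \max_I (w I + N I))%N by exact: (leq_bigmax_cond I).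
  rewrite (big_cat_nat (leq0n _) le) //= [X in _ + X]big_nat_cond.
  rewrite [X in _ + X]big1 ?addr0; last first.
    by move=> i /andP[/andP[+ _] _]; rewrite leqNgt => /negbTE ->; rewrite andbF.
  rewrite (big_cat_nat (leq0n _) (leq_addr (N I) (w I))) //= [X in X + _]big_nat_cond.
  rewrite [X in X + _]big1 ?add0r; last first.
    by move=> i /andP[/andP[_ +] _]; rewrite ltnNge => /negbTE ->.
  rewrite -[X in \sum_(X <= _ < _) _]add0n big_addn addKn -[LHS](big_mkord predT (g I)).
  rewrite [RHS]big_nat_cond [LHS]big_nat_cond; apply: eq_bigr => i.
  by rewrite !andbT => /andP[_ iN]; rewrite leq_addl addnC ltn_add2l iN addKn.
apply/ffunP => I; rewrite XE ffunMnE ffunE; case: ifP => [/andP[wm _]|_].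
  by rewrite (fg I).2 mulr_natl -mulrnDr subnK.
rewrite mulr0 addr0 mul0rn big1 // => i _; rewrite big1 // => j _.
by rewrite raddf0 mulr0.
Qed.

Lemma decomposable_row a : decomposable (R a a).
Proof.
apply: (@decomposable_weight (fun ij => ij.1 == a) (fun=> 0%N)) => f I.
rewrite ffunE mul0r addr0 /=.
rewrite [RHS](bigD1 a) //= [X in _ = _ + X]big1 => [|i ia].
  by rewrite addr0; apply: eq_bigl => j; rewrite eqxx.
by rewrite big_pred0 // => j; apply: negbTE.
Qed.

Lemma decomposable_col a : decomposable (L a a).
Proof.
apply: (@decomposable_weight (fun ij => ij.2 == a) (fun I => slots I a) (L a a)) => f I.
rewrite colop_diag; congr (_ + _); apply: eq_bigr => i _.
by rewrite big_pred1_eq.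
Qed.

Lemma decomposable_euler : decomposable E.
Proof.
apply: (@decomposable_weight predT (fun=> 0%N)) => f I.
by rewrite eulerE mul0r addr0.
Qed.

Lemma eulerD f g : E (f + g) = E f + E g.
Proof. by rewrite /euler !rowopD addrACA. Qed.

(** Eigencomponents of an element of the stable space [Q] stay in [Q], so a claim about [Q] reduces
    to eigenvectors. Iterating with [Q] cut down by the eigenvalue conditions already obtained leads
    to simultaneous eigenvectors. *)
Lemma eigen_ind (X : T -> T) Q U : decomposable X ->
  {morph X : f g / f + g} -> linear_space Q -> (forall f, Q f -> F f) ->
  (forall f, Q f -> Q (X f)) -> U 0 -> (forall f g, U f -> U g -> U (f + g)) ->
  (forall m f, Q f -> X f = f *+ m -> U f) -> forall f, Q f -> U f.
Proof.
move=> decX XD linQ QF QX U0 UD UX f Qf.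
have [N [g [fg Xg]]] := decX f (QF f Qf).
have Qg m : (m < N)%N -> Q (g m).
  apply: (@eigencomponents _ X Q XD _ _ _ QX N g Xg); last by rewrite -fg.
  - by case: linQ.
  - exact: linB.
  - exact: lin_div.
by rewrite fg; apply: big_ind => // m _; apply: UX (Qg _ _) (Xg m).
Qed.


Lemma polyregular_euler f : F f -> F (E f).
Proof. by move=> Ff; apply: polyregularD; apply: polyregular_row. Qed.

Lemma morphMn (X : T -> T) : {morph X : f g / f + g} ->
  forall f m, X (f *+ m) = X f *+ m.
Proof.
move=> XD f; elim=> [|m IHm]; last by rewrite !mulrS XD IHm.
by rewrite !mulr0n; apply: (addrI (X 0)); rewrite -XD !addr0.
Qed.

Lemma morph0 (X : T -> T) : {morph X : f g / f + g} -> X 0 = 0.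
Proof. by move=> XD; apply: (addrI (X 0)); rewrite -XD !addr0. Qed.

Lemma rowMn a b f m : R a b (f *+ m) = R a b f *+ m.
Proof. exact: (morphMn (rowopD z d a b)). Qed.

Lemma colMn a b f m : L a b (f *+ m) = L a b f *+ m.
Proof. exact: (morphMn (colopD z d a b)). Qed.

Lemma shiftMn a b f m : S a b (f *+ m) = S a b f *+ m.
Proof. exact: (morphMn (shiftopD d a b)). Qed.

Lemma mulrn_inj f p q : f != 0 -> f *+ p = f *+ q -> p = q.
Proof.
move=> f0 /ffunP fpq; have [I fI|all0] := pickP (fun I => f I != 0); last first.
  case/eqP: f0; apply/ffunP => I; rewrite ffunE.
  by have := all0 I => /= /negbFE/eqP.
have := fpq I; rewrite !ffunMnE -[_ *+ p]mulr_natl -[_ *+ q]mulr_natl.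
move/(mulIf fI); rewrite -!(rmorph_nat iota) => /fmorph_inj/eqP.
by rewrite eqr_nat => /eqP.
Qed.

Lemma mulrn_eq0K f m : f *+ m.+1 = 0 -> f = 0.
Proof.
move=> /ffunP f0; apply/ffunP => I; have := f0 I; rewrite ffunMnE ffunE => /eqP.
by rewrite -mulr_natl mulf_eq0 -(rmorph_nat iota) fmorph_eq0 pnatr_eq0 => /eqP.
Qed.

Lemma linear_space_eigen (X : T -> T) m : {morph X : f g / f + g} ->
  (forall c f, X (scl (iota c) f) = scl (iota c) (X f)) ->
  linear_space (fun f => X f = f *+ m).
Proof.
move=> XD XZ; split.
- by rewrite mul0rn -[0](mulr0n 0) morphMn.
- by move=> f g Xf Xg; rewrite XD Xf Xg mulrnDl.
- by move=> c f Xf; rewrite XZ Xf; apply/ffunP => I; rewrite !(ffunE, ffunMnE) mulrnAr.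
Qed.

Lemma linear_spaceI Q U : linear_space Q -> linear_space U ->
  linear_space (fun f => Q f /\ U f).
Proof.
move=> [Q0 QD QZ] [U0 UD UZ]; split=> //.
- by move=> f g [Qf Uf] [Qg Ug]; split; [apply: QD|apply: UD].
- by move=> c f [Qf Uf]; split; [apply: QZ|apply: UZ].
Qed.

Lemma rowZ a b c f : R a b (scl (iota c) f) = scl (iota c) (R a b f).
Proof. exact: rowopZ. Qed.

Lemma colZ a b c f : L a b (scl (iota c) f) = scl (iota c) (L a b f).
Proof. exact: colopZ. Qed.

Lemma eulerZ c f : E (scl (iota c) f) = scl (iota c) (E f).
Proof.
by rewrite /euler !rowZ; apply/ffunP => I; rewrite !ffunE mulrDr.
Qed.

Lemma eulerN a b f : a != b -> E f = R a a f + R b b f.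
Proof.
rewrite /euler; case: (ord2P a) => ->; case: (ord2P b) => -> // _.
by rewrite addrC.
Qed.

Lemma col_diagN a b f : a != b -> L a a f + L b b f = E f + f *+ n.
Proof.
rewrite -euler_diag //; case: (ord2P a) => ->; case: (ord2P b) => -> // _.
by rewrite addrC.
Qed.

Lemma euler_row a b f : E (R a b f) = R a b (E f).
Proof.
case: (b =P a) => [->|/eqP ba].
  by rewrite /euler rowopD; case: (ord2P a) => ->; congr (_ + _); rewrite row_rowC.
rewrite !(eulerN _ ba) rowopD -(row_row_r dM dz dC _ ba).
by rewrite (row_row dM dz dC _ ba) addrA.
Qed.

Lemma euler_col a b f : E (L a b f) = L a b (E f).
Proof. by rewrite /euler !row_colC // colopD. Qed.

(** The sum [colop a a] + [colop b b] is the Euler operator plus n, and the Euler operator commutes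
    with every [colop]. *)
Lemma col_colC a b f : a != b -> L a a (L b b f) = L b b (L a a f).
Proof.
move=> ab; apply: (addrI (L a a (L a a f))).
rewrite -colopD col_diagN // colopD colMn -euler_col.
by rewrite -(col_diagN _ ab).
Qed.

(** * Constant tensors and their weight vectors *)

Definition constant f := forall I, exists c, f I = iota c.

Lemma constant_d f a b I : constant f -> d a b (f I) = 0.
Proof. by move=> /(_ I)[c ->]. Qed.

Lemma constant_row f a b : constant f -> R a b f = 0.
Proof.
move=> cf; apply/ffunP => I; rewrite !ffunE big1 // => e _.
by rewrite constant_d // mulr0.
Qed.

Lemma constant_colE f a b I : constant f ->
  L a b f I = \sum_(k | I k == a) f (put I k b).
Proof.
move=> cf; rewrite ffunE big1 ?add0r // => e _.
by rewrite constant_d // mulr0.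
Qed.

Lemma constant_col f a b : constant f -> constant (L a b f).
Proof.
move=> cf I; rewrite constant_colE //.
apply: (big_ind (fun x => exists c, x = iota c)).
- by exists 0; rewrite rmorph0.
- by move=> _ _ [x ->] [y ->]; exists (x + y); rewrite rmorphD.
- by move=> k _; apply: cf.
Qed.

Lemma euler0_constant f : F f -> E f = 0 -> constant f.
Proof.
move=> [_ Pf _] /ffunP Ef I; apply: pol_const => //.
by have := Ef I; rewrite eulerE ffunE.
Qed.

Lemma linear_space_constant : linear_space constant.
Proof.
split.
- by move=> I; exists 0; rewrite ffunE rmorph0.
- move=> f g cf cg I; have [x fI] := cf I; have [y gI] := cg I.
  by exists (x + y); rewrite ffunE fI gI rmorphD.
- move=> c f cf I; have [x fI] := cf I.
  by exists (c * x); rewrite ffunE fI rmorphM.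
Qed.

(* The symmetrization of [e_0^(x m) (x) e_1^(x (n - m))], up to a factor. *)
Definition weightvec m : T := [ffun I => (slots I 0 == m)%:R].

(** With two possible values, the number of zeros fixes the multiset of values of an index, hence
    its orbit under permutations of the slots. *)
Lemma symmetric_tensor_slots f I J : symmetric_tensor f -> slots I 0 = slots J 0 ->
  f I = f J.
Proof.
move=> Sf IJ; have : perm_eq [tuple I k | k < n] [tuple J k | k < n].
  apply/seq.permP => p.
  have H (X : idx) : count p [tuple X k | k < n]
     = (p 0%R * slots X 0%R + p 1%R * slots X 1%R)%N.
    rewrite -sum1_count big_tuple big_mkcond.
    rewrite mulnC (mulnC (p 1%R)) /slots -!sum_nat_const.
    rewrite [X in _ = (X + _)%N]big_mkcond [X in _ = (_ + X)%N]big_mkcond.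
    rewrite -big_split /=.
    apply: eq_bigr => k _; rewrite tnth_mktuple !inE.
    by case: (ord2P (X k)) => ->; case: (p _).
  have /addnI E1 : addn (slots I 0) (slots I 1) = addn (slots I 0) (slots J 1).
    by rewrite [in RHS]IJ !slotsD.
  by rewrite !H E1 IJ.
move=> /tuple_permP[s /val_inj Es]; rewrite -(Sf s J); congr (f _).
apply/ffunP => k; rewrite ffunE.
by have := congr1 (fun t => tnth t k) Es; rewrite !tnth_mktuple.
Qed.

(** On constants [colop 0 0] multiplies component [I] by [slots I 0]. An eigenvector is thus
    supported on the indices with m zeros, where symmetry makes it constant; if there are none, it
    vanishes and c = 0 serves. *)
Lemma constant_weightvec f m : symmetric_tensor f -> constant f ->
  L 0 0 f = f *+ m -> exists c, f = scl (iota c) (weightvec m).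
Proof.
move=> Sf cf /ffunP Lf.
have f0 I : slots I 0 != m -> f I = 0.
  move=> Im; have := Lf I; rewrite colop_diag big1 => [|e _]; last first.
    by rewrite constant_d // mulr0.
  rewrite add0r ffunMnE -[_ *+ m]mulr_natl => /eqP.
  rewrite -subr_eq0 -mulrBl mulf_eq0 => /orP[|/eqP //].
  rewrite -!(rmorph_nat iota) -rmorphB fmorph_eq0 subr_eq0 eqr_nat.
  by rewrite (negbTE Im).
have [I Im|noI] := pickP (fun I => slots I 0 == m).
  have [c fI] := cf I; exists c; apply/ffunP => J; rewrite !ffunE -fI.
  case: eqP => [Jm|/eqP/f0 ->]; last by rewrite mulr0.
  by rewrite mulr1; apply: symmetric_tensor_slots; rewrite // Jm; apply/esym/eqP.
exists 0; apply/ffunP => J; rewrite !ffunE noI mulr0.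
by apply: f0; rewrite noI.
Qed.

Lemma weightvec_constant m : constant (weightvec m).
Proof. by move=> I; exists (slots I 0 == m)%:R; rewrite ffunE rmorph_nat. Qed.

(** The factor m+1 counts the zeros of an index of the target weight, any of which may be the slot
    just changed. Downwards the ones are counted instead, which gives n - m. *)
Lemma weightvec_up m : L 0 1 (weightvec m) = weightvec m.+1 *+ m.+1.
Proof.
apply/ffunP => I; rewrite constant_colE; last exact: weightvec_constant.
rewrite ffunMnE ffunE.
under eq_bigr => k /eqP Ik.
  rewrite ffunE -eqSS (slots_put_from _ Ik) //; over.
by rewrite sumr_const; case: eqP => [<-|_]; rewrite ?mul0rn.
Qed.

Lemma weightvec_down m : (m < n)%N ->
  L 1 0 (weightvec m.+1) = weightvec m *+ (n - m).
Proof.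
move=> mn; apply/ffunP => I; rewrite constant_colE; last exact: weightvec_constant.
rewrite ffunMnE ffunE.
under eq_bigr => k /eqP Ik.
  rewrite ffunE (slots_put _ Ik) // eqSS; over.
rewrite sumr_const; case: eqP => [H|_]; rewrite ?mul0rn //.
have := congr1 (subn^~ (slots I 0)) (slotsD I (isT : 0 != 1 :> 'I_2)).
by rewrite /= addKn H => <-.
Qed.

(** * Nonzero sp(4)-submodules *)

Section Submodule.
Variable W : T -> Prop.
Hypothesis linW : linear_space W.
Hypothesis WF : forall f, W f -> F f.
Hypothesis W_shift : forall a b f, W f -> W (S a b f + S b a f).
Hypothesis W_raise : forall a b f, W f -> W (C a b f + C b a f).
Hypothesis W_levi : forall a b f, W f -> W (R b a f + L b a f).
Hypothesis W_neq0 : exists f, W f /\ f <> 0.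

Let W0 : W 0. Proof. by case: linW. Qed.
Let WD f g : W f -> W g -> W (f + g). Proof. by case: linW => _ D _; apply: D. Qed.
Let WZ c f : W f -> W (scl (iota c) f). Proof. by case: linW => _ _; apply. Qed.

Lemma W_shift_diag a f : W f -> W (S a a f).
Proof. by move/(W_shift a a); rewrite -mulr2n; apply: lin_div. Qed.

Lemma W_raise_diag a f : W f -> W (C a a f).
Proof. by move/(W_raise a a); rewrite -mulr2n; apply: lin_div. Qed.

(** The two diagonal elements of GL(2) add up to 2 [euler] + n, from which the scalar and the factor
    2 are removed. *)
Lemma W_euler f : W f -> W (E f).
Proof.
move=> Wf; have := WD (W_levi 0 0 Wf) (W_levi 1 1 Wf).
rewrite addrACA euler_diag // -/(E f) addrA -mulr2n addrC.
by apply: lin_cancel => //; apply: linMn.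
Qed.

Lemma W_euler_eigenvector : exists m f, [/\ W f, f != 0 & E f = f *+ m].
Proof.
have [f [Wf f0]] := W_neq0.
have [N [g [fg Eg]]] := decomposable_euler (WF Wf).
have Wg m : (m < N)%N -> W (g m).
  apply: (@eigencomponents _ E W eulerD _ _ _ W_euler N g Eg) => //.
  - exact: linB.
  - exact: lin_div.
  - by rewrite -fg.
have [m m0|all0] := pickP (fun m : 'I_N => g m != 0).
  by exists m, (g m); split=> //; apply: Wg.
case: f0; rewrite fg big1 // => m _; apply/eqP.
by have := all0 m; rewrite /= => /negbFE.
Qed.

(** Only the sum of d_01 and d_10 is known to vanish; slot 0 separates the two. If its index is 0,
    regularity turns d_01 into d_00 of another component. If it is 1, then d_01 = - d_10 and
    regularity turns d_10 into d_11. *)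
Lemma regular_shift0 f : regular d f -> S 0 0 f = 0 -> S 1 1 f = 0 ->
  S 0 1 f + S 1 0 f = 0 -> forall a b, S a b f = 0.
Proof.
move=> Rf /ffunP f00 /ffunP f11 /ffunP f01.
have {}f00 I : d 0 0 (f I) = 0 by have := f00 I; rewrite !ffunE.
have {}f11 I : d 1 1 (f I) = 0 by have := f11 I; rewrite !ffunE.
have {}f01 I : d 0 1 (f I) = - d 1 0 (f I).
  by apply/eqP; rewrite -addr_eq0; have := f01 I; rewrite !ffunE => ->.
pose k := Ordinal n_gt0.
have H I : d 0 1 (f I) = 0.
  rewrite -(put_id I k); case: (ord2P (I k)) => ->; first by rewrite Rf f00.
  by rewrite f01 -Rf f11 oppr0.
move=> a b; apply/ffunP => I; rewrite !ffunE.
case: (ord2P a) => ->; case: (ord2P b) => -> //.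
by apply/eqP; rewrite -oppr_eq0 -f01 H.
Qed.

(** Each nonzero symmetric shift of an Euler eigenvector in [W] is again one, of eigenvalue one
    less. If in positive degree all three vanish, then every derivative vanishes and so does [E f],
    a contradiction. *)
Lemma W_constant : exists f, [/\ W f, f != 0 & constant f].
Proof.
have [m [f [Wf f0 Ef]]] := W_euler_eigenvector.
elim: m f Wf f0 Ef => [|m IHm] f Wf f0 Ef.
  by exists f; split=> //; apply: euler0_constant => //; apply: WF.
have Es a b : E (S a b f) = S a b f *+ m.
  apply: (addIr (S a b f)); rewrite euler_shift // Ef shiftMn.
  by rewrite mulrSr.
have [f00|f00] := eqVneq (S 0 0 f) 0; last first.
  by apply: (IHm (S 0 0 f)) => //; apply: W_shift_diag.
have [f11|f11] := eqVneq (S 1 1 f) 0; last first.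
  by apply: (IHm (S 1 1 f)) => //; apply: W_shift_diag.
have [f01|f01] := eqVneq (S 0 1 f + S 1 0 f) 0; last first.
  apply: (IHm (S 0 1 f + S 1 0 f)) => //; first exact: W_shift.
  by rewrite eulerD !Es mulrnDl.
have [_ _ /regular_shift0/(_ f00 f11 f01) s0] := WF Wf.
have : E f = 0.
  apply/ffunP => I; rewrite eulerE ffunE big1 // => a _; rewrite big1 // => b _.
  have /ffunP/(_ I) := s0 a b.
  by rewrite !ffunE => ->; rewrite mulr0.
by rewrite Ef => /mulrn_eq0K /eqP; rewrite (negbTE f0).
Qed.

(** On constants GL(2) acts through its column part alone, so here, unlike in general, [W] is stable
    under single column operators. *)
Lemma W_constant_col a b f : W f -> constant f -> W (L a b f).
Proof.
by move=> Wf cf; have := W_levi b a Wf; rewrite constant_row // add0r.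
Qed.

Lemma linear_spaceWC : linear_space (fun f => W f /\ constant f).
Proof. by apply: linear_spaceI => //; apply: linear_space_constant. Qed.

(** The column weight components of a nonzero constant of [W] stay in [W], so some weight vector
    belongs to it. Lowering reaches weight 0 and raising then reaches every other weight; the
    factors met on the way are nonzero. *)
Lemma W_weightvec m : (m <= n)%N -> W (weightvec m).
Proof.
have [f [Wf f0 cf]] := W_constant.
have [i [i_n Wi]] : exists i, (i <= n)%N /\ W (weightvec i).
  have [N [g [fg Lg]]] := decomposable_col 0 (WF Wf).
  have Wg j : (j < N)%N -> W (g j) /\ constant (g j).
    apply: (@eigencomponents _ (L 0 0) (fun f => W f /\ constant f)
             (colopD z d 0 0) _ _ _ _ N g Lg); last by rewrite -fg.
    - by case: linear_spaceWC.
    - exact: linB linear_spaceWC.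
    - exact: lin_div linear_spaceWC.
    - move=> x [Wx cx]; split; [exact: W_constant_col|exact: constant_col].
  have [i i0|all0] := pickP (fun m : 'I_N => g m != 0); last first.
    case/eqP: f0; rewrite fg big1 // => j _; apply/eqP.
    by have := all0 j; rewrite /= => /negbFE.
  have [Wi ci] := Wg i (ltn_ord i); have [Si _ _] := WF Wi.
  have [c gi] := constant_weightvec Si ci (Lg i).
  have c0 : c != 0.
    apply: contra i0 => /eqP c0; rewrite gi c0 rmorph0.
    by apply/eqP/ffunP => I; rewrite !ffunE mul0r.
  exists i; split; last first.
    have := WZ c^-1 Wi; rewrite gi sclA -rmorphM mulVf // rmorph1.
    by rewrite scl1.
  rewrite leqNgt; apply: contra i0 => ni; rewrite gi.
  apply/eqP/ffunP => I; rewrite !ffunE.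
  case: eqP => [Ii|_]; last by rewrite mulr0.
  by move: ni; rewrite -Ii ltnNge slots_le.
have up j : W (weightvec j) -> W (weightvec j.+1).
  move=> Wj; apply: (@lin_div _ linW _ j); rewrite -weightvec_up.
  by apply: W_constant_col => //; apply: weightvec_constant.
have down j : (j < n)%N -> W (weightvec j.+1) -> W (weightvec j).
  move=> jn Wj; apply: (@lin_div _ linW _ (n - j).-1).
  rewrite prednK ?subn_gt0 // -weightvec_down //.
  by apply: W_constant_col => //; apply: weightvec_constant.
have W00 : W (weightvec 0).
  by elim: i i_n Wi => // i IHi i_n /(down _ i_n)/IHi; apply; apply: ltnW.
by move=> _; elim: m => // m; apply: up.
Qed.

Lemma W_constants f : F f -> constant f -> W f.
Proof.
move=> Ff cf.
apply: (@eigen_ind (L 0 0) (fun f => F f /\ constant f) W (decomposable_col 0)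
         (colopD z d 0 0)) => //.
- apply: linear_spaceI; first exact: linear_space_polyregular.
  exact: linear_space_constant.
- by move=> g [].
- by move=> g [Fg cg]; split; [exact: polyregular_col|exact: constant_col].
move=> m g [[Sg Pg Rg] cg] Lg; have [c gc] := constant_weightvec Sg cg Lg.
have [mn|nm] := leqP m n; first by rewrite gc; apply: WZ; apply: W_weightvec.
suff -> : g = 0 by [].
rewrite gc; apply/ffunP => I; rewrite !ffunE.
case: eqP => [Im|_]; last by rewrite mulr0.
by move: nm; rewrite -Im ltnNge slots_le.
Qed.

(** * Induction on the degree *)

Section DegreeStep.
Variable m : nat.
Hypothesis W_m : forall f, F f -> E f = f *+ m -> W f.

Lemma W_shiftF a b f : F f -> E f = f *+ m.+1 -> W (S a b f).
Proof.
move=> Ff Ef; apply: W_m; first exact: polyregular_shift.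
apply: (addIr (S a b f)); rewrite euler_shift // Ef shiftMn.
by rewrite mulrSr.
Qed.

Lemma W_weight_step a f p i : F f -> E f = f *+ m.+1 ->
  R a a f = f *+ p.+1 -> L a a f = f *+ i.+1 -> W f.
Proof.
move=> Ff Ef Rf Lf; have [_ _ reg] := Ff.
apply: (@lin_div _ linW _ i); apply: (@lin_div _ linW _ p).
rewrite mulrnAC -Rf -rowMn -Lf -raise_shift //.
by apply: W_raise_diag; apply: W_shiftF.
Qed.

(* Here [a] is the only occupied row and [b] the only occupied column. Both
   [raiseop b a (shiftop a b f)], a multiple of [f], and
   [raiseop a b (shiftop a b f)], to which [W_weight_step] applies, are considered
   since only the sum of the two raising operators lies in sp(4). *)
Lemma W_extremal_step a b f : a != b -> F f -> E f = f *+ m.+1 ->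
  R b b f = 0 -> L a a f = 0 -> W f.
Proof.
move=> ab Ff Ef Rb La; have [_ _ reg] := Ff.
have Ra : R a a f = f *+ m.+1 by rewrite -Ef (eulerN _ ab) Rb addr0.
have Lb : L b b f = f *+ (m.+1 + n).
  by rewrite mulrnDr -Ef -(col_diagN _ ab) La add0r.
have Wab := W_raise a b (W_shiftF a b Ff Ef).
(* One summand is f times (m+1)(m+1+n), put into successor form so that [lin_cancel] can divide by
   it. *)
rewrite !raise_shift // Lb rowMn Ra -mulrnA addnC addnS mulnC mulSn in Wab.
have h0 : W (R b a (L a b f)).
  have LLab : L b b (L a b f) = L a b f *+ (m + n).
    apply: (addIr (L a b f)); rewrite col_col // Lb colMn.
    by rewrite addSn mulrSr.
  (* The other summand has row weight 0 + 1 and column weight (m+1+n) - 1 at b; the latter is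
     positive because n > 0, even for m = 0. *)
  apply: (@W_weight_step b _ 0 (m + n).-1).
  - by apply: polyregular_row; apply: polyregular_col.
  - by rewrite euler_row euler_col Ef colMn rowMn.
  - rewrite row_row // [R b b (L _ _ _)]row_colC // Rb.
    by rewrite (morph0 (colopD z d a b)) (morph0 (rowopD z d b a)) addr0.
  - by rewrite prednK ?addn_gt0 ?n_gt0 ?orbT // -row_colC // LLab rowMn.
by apply: lin_cancel h0 Wab.
Qed.

(** The four commuting diagonal operators are split off one after another inside F+ in degree m+1,
    since [W] is not known to be stable under any of them. *)
Lemma W_degree_step f : F f -> E f = f *+ m.+1 -> W f.
Proof.
move=> Ff Ef.
have lin0 : linear_space (fun f => F f /\ E f = f *+ m.+1).
  apply: linear_spaceI; first exact: linear_space_polyregular.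
  by apply: linear_space_eigen; [exact: eulerD|exact: eulerZ].
have linR a p Q : linear_space Q -> linear_space (fun f => Q f /\ R a a f = f *+ p).
  move=> linQ; apply: linear_spaceI => //.
  by apply: linear_space_eigen; [exact: rowopD|exact: rowZ].
have linL a p Q : linear_space Q -> linear_space (fun f => Q f /\ L a a f = f *+ p).
  move=> linQ; apply: linear_spaceI => //.
  by apply: linear_space_eigen; [exact: colopD|exact: colZ].
apply: (eigen_ind (decomposable_row 0) (rowopD z d 0 0) lin0 _ _ W0 WD) (conj Ff Ef).
- by move=> g [].
- by move=> g [Fg Eg]; split; [exact: polyregular_row|rewrite euler_row Eg rowMn].
move=> p f0 Hf0 Rp.
apply: (eigen_ind (decomposable_row 1) (rowopD z d 1 1) (linR 0 p _ lin0)
  _ _ W0 WD) (conj Hf0 Rp).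
- by move=> g [[]].
- move=> g [[Fg Eg] Rg]; split; last by rewrite row_rowC // Rg rowMn.
  by split; [exact: polyregular_row|rewrite euler_row Eg rowMn].
move=> q f1 Hf1 Rq.
apply: (eigen_ind (decomposable_col 0) (colopD z d 0 0)
  (linR 1 q _ (linR 0 p _ lin0)) _ _ W0 WD) (conj Hf1 Rq).
- by move=> g [[[]]].
- move=> g [[[Fg Eg] Rg] Rg1]; split; last by rewrite row_colC // Rg1 colMn.
  split; last by rewrite row_colC // Rg colMn.
  by split; [exact: polyregular_col|rewrite euler_col Eg colMn].
move=> i f2 Hf2 Li.
apply: (eigen_ind (decomposable_col 1) (colopD z d 1 1)
  (linL 0 i _ (linR 1 q _ (linR 0 p _ lin0))) _ _ W0 WD) (conj Hf2 Li).
- by move=> g [[[[]]]].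
- move=> g [[[[Fg Eg] Rg] Rg1] Lg]; split; last by rewrite col_colC // Lg colMn.
  split; last by rewrite row_colC // Rg1 colMn.
  split; last by rewrite row_colC // Rg colMn.
  by split; [exact: polyregular_col|rewrite euler_col Eg colMn].
move=> j g [[[[Fg Eg] Rp0] Rq1] Li0] Lj1.
have [-> //|g0] := eqVneq g 0.
have pq : (p + q = m.+1)%N.
  apply: (mulrn_inj g0); rewrite mulrnDr -Rp0 -Rq1.
  by rewrite -(eulerN g (isT : 0 != 1 :> 'I_2)).
have ij : (i + j = m.+1 + n)%N.
  apply: (mulrn_inj g0); rewrite !mulrnDr -Li0 -Lj1.
  by rewrite (col_diagN g (isT : 0 != 1 :> 'I_2)) Eg.
(* As p + q and i + j are positive, the products p i and q j both vanish only for p = j = 0 or q = i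
   = 0. These are the two extremal cases. *)
case: p pq Rp0 {Hf0 Hf1 Hf2 Rp} => [|p] pq Rp0.
  case: j ij Lj1 => [|j] ij Lj1; last first.
    rewrite add0n in pq; rewrite pq in Rq1.
    exact: W_weight_step Fg Eg Rq1 Lj1.
  by apply: (@W_extremal_step 1 0).
case: i ij Li0 {Li} => [|i] ij Li0; last exact: W_weight_step Fg Eg Rp0 Li0.
case: q pq Rq1 {Rq} => [|q] pq Rq1; first exact: (@W_extremal_step 0 1).
by rewrite add0n in ij; rewrite ij addSn in Lj1; apply: W_weight_step Fg Eg Rq1 Lj1.
Qed.

End DegreeStep.

Theorem submodule_full f : F f -> W f.
Proof.
have W_deg m g : F g -> E g = g *+ m -> W g.
  elim: m g => [|m IHm] g Fg Eg.
    by apply: W_constants => //; apply: euler0_constant.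
  exact: (W_degree_step IHm).
apply: (eigen_ind decomposable_euler eulerD linear_space_polyregular _
  polyregular_euler W0 WD) => //.
Qed.

End Submodule.
End Irreducibility.

(** * Irreducibility of F+ *)

Section WeightedEuler.
Variables (m : nat) (R : comNzRingType) (A : pred 'I_m).
Implicit Types (p : {mpoly R[m]}) (u : 'X_{1..m}).

Definition mweuler p := \sum_(i | A i) 'X_i * p^`M(i).
Definition mwdeg u := (\sum_(i | A i) u i)%N.

Lemma mweulerX u : mweuler 'X_[u] = 'X_[u] *+ mwdeg u.
Proof.
rewrite /mweuler -sumrMnr; apply: eq_bigr => i _.
rewrite mderivX -scalerAr scaler_nat.
have [->|ui] := eqVneq (u i) 0%N; first by rewrite !mulr0n.
rewrite -mpolyXD addmC submK //; apply/mnm_lepP => k; rewrite mnm1E.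
by case: eqP => // <-; rewrite lt0n.
Qed.

Lemma mweulerD p q : mweuler (p + q) = mweuler p + mweuler q.
Proof.
by rewrite -big_split; apply: eq_bigr => i _; rewrite /= mderivD mulrDr.
Qed.

Lemma mweulerZ c p : mweuler (c *: p) = c *: mweuler p.
Proof.
by rewrite scaler_sumr; apply: eq_bigr => i _; rewrite mderivZ scalerAr.
Qed.

Lemma mweuler_sum J (r : seq J) (B : pred J) (G : J -> {mpoly R[m]}) :
  mweuler (\sum_(j <- r | B j) G j) = \sum_(j <- r | B j) mweuler (G j).
Proof.
apply: (big_morph mweuler mweulerD).
by rewrite /mweuler big1 // => i _; rewrite mderiv0 mulr0.
Qed.

Lemma mcoeff_mweuler p u : (mweuler p)@_u = p@_u *+ mwdeg u.
Proof.
rewrite {1}[p]mpolyE mweuler_sum.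
rewrite (eq_bigr (fun v => (p@_v *+ mwdeg v) *: 'X_[v])) => [|v _].
  rewrite raddf_sum; transitivity (\sum_(v <- msupp p) (p@_v *: 'X_[v])@_u *+ mwdeg u).
    apply: eq_bigr => v _.
      rewrite /= !mcoeffZ mcoeffX; case: eqP => [->|_]; last by rewrite !mulr0 ?mul0rn.
      by rewrite !mulr1.
  by rewrite sumrMnl -raddf_sum -mpolyE.
by rewrite mweulerZ mweulerX -scalerMnr scalerMnl.
Qed.

Lemma mweuler_components p : exists N (g : nat -> {mpoly R[m]}),
  p = \sum_(k < N) g k /\ forall k, mweuler (g k) = g k *+ k.
Proof.
pose g k := \sum_(u <- msupp p | mwdeg u == k) p@_u *: 'X_[u].
exists (\max_(u <- msupp p) mwdeg u).+1, g; split=> [|k].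
  under [RHS]eq_bigr => k _ do rewrite /g big_mkcond /=.
  rewrite exchange_big /= {1}[p]mpolyE; apply: eq_big_seq => u up.
  have ltu : (mwdeg u < (\max_(u <- msupp p) mwdeg u).+1)%N.
    by rewrite ltnS; apply: (leq_bigmax_seq (F := mwdeg)).
  by rewrite -big_mkcond (big_pred1 (Ordinal ltu)) // => k; rewrite eq_sym.
rewrite mweuler_sum /g -sumrMnl; apply: eq_bigr => u /eqP <-.
by rewrite mweulerZ mweulerX scalerMnr.
Qed.

End WeightedEuler.

(** * Expanding traces and slot sums in the entries of a constant matrix *)

Section MatrixSums.
Variables (K : comNzRingType) (Z : 'M[K]_2) (D : 'I_2 -> 'I_2 -> K).

Lemma sum_mulmxZ (A : 'M[K]_2) : \sum_i \sum_j (A *m Z) i j * D i j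
  = \sum_a \sum_b A a b * (\sum_e Z b e * D a e).
Proof. by rewrite !sum_ord2 !mxE !sum_ord2; ring. Qed.

Lemma sum_mulZmx (A : 'M[K]_2) : \sum_i \sum_j (Z *m A) i j * D i j
  = \sum_a \sum_b A a b * (\sum_e Z e a * D e b).
Proof. by rewrite !sum_ord2 !mxE !sum_ord2; ring. Qed.

Lemma sum_mulZmxZ (A : 'M[K]_2) : \sum_i \sum_j (Z *m A *m Z) i j * D i j
  = \sum_a \sum_b A a b * (\sum_i Z i a * (\sum_j Z b j * D i j)).
Proof. by rewrite !sum_ord2 !mxE !sum_ord2 !mxE !sum_ord2; ring. Qed.

Lemma mxtrace_mulZ (A : 'M[K]_2) : \tr (A *m Z) = \sum_a \sum_b A a b * Z b a.
Proof. by rewrite /mxtrace; apply: eq_bigr => i _; rewrite mxE. Qed.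

Lemma sum_slots n (I : {ffun 'I_n -> 'I_2}) (G : 'I_2 -> 'I_n -> K) :
  \sum_k G (I k) k = \sum_a \sum_(k | I k == a) G a k.
Proof.
rewrite (partition_big I predT) //=; apply: eq_bigr => a _.
by apply: eq_bigr => k /eqP ->.
Qed.

Lemma sum_slots_mx n (I : {ffun 'I_n -> 'I_2}) (A : 'M[K]_2)
    (G : 'I_n -> 'I_2 -> K) :
  \sum_k \sum_j A (I k) j * G k j
  = \sum_a \sum_b A a b * (\sum_(k | I k == a) G k b).
Proof.
rewrite (sum_slots I (fun i k => \sum_j A i j * G k j)).
apply: eq_bigr => a _ /=; rewrite exchange_big /=.
by apply: eq_bigr => b _; rewrite mulr_sumr.
Qed.

Lemma sum_slots_mulmxZ n (I : {ffun 'I_n -> 'I_2}) (A : 'M[K]_2)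
    (G : 'I_n -> 'I_2 -> K) :
  \sum_k \sum_j (A *m Z) (I k) j * G k j
  = \sum_a \sum_b A a b * (\sum_(k | I k == a) \sum_j Z b j * G k j).
Proof.
rewrite (sum_slots I (fun i k => \sum_j (A *m Z) i j * G k j)).
apply: eq_bigr => a _ /=; under [RHS]eq_bigr => b _ do rewrite mulr_sumr.
rewrite [RHS]exchange_big /=; apply: eq_bigr => k _ /=.
under eq_bigr => j _ do rewrite mxE mulr_suml.
rewrite exchange_big /=; apply: eq_bigr => b _ /=; rewrite mulr_sumr.
by apply: eq_bigr => j _; rewrite mulrA.
Qed.
End MatrixSums.

(** * The action of gl(4) through the row, column, shift and raising operators *)

Section LeftRegularPolynomials.
Variable C : numFieldType.
Variable n : nat.
Local Notation P := (zpoly C).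
Local Notation K := (zfrac C).
Local Notation z := (@Zmx C).
Local Notation idx := {ffun 'I_n -> 'I_2}.
Local Notation T := (tens C n).
Implicit Types (f g : T) (I : idx) (a b i j : 'I_2).

Definition pdz i j : {additive K -> K} := @pd C i j.

Lemma is_polyC (c : C) : is_poly (cst c).
Proof. by exists c%:MP; rewrite cstE. Qed.

Lemma is_polyD (x y : K) : is_poly x -> is_poly y -> is_poly (x + y).
Proof. by move=> [p ->] [q ->]; exists (p + q); rewrite pfracD. Qed.

Lemma is_polyM (x y : K) : is_poly x -> is_poly y -> is_poly (x * y).
Proof. by move=> [p ->] [q ->]; exists (p * q); rewrite pfracM. Qed.

Lemma is_poly_z i j : is_poly (z i j).
Proof. by exists 'X_(mxvec_index i j); rewrite ZmxE. Qed.

Lemma is_poly_pd i j (x : K) : is_poly x -> is_poly (pdz i j x).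
Proof. by move=> [p ->]; exists p^`M(mxvec_index i j); rewrite /pdz /= pd_pfrac. Qed.

Lemma pfrac_mweuler (A : pred ('I_2 * 'I_2)) (p : P) :
  \sum_i \sum_(j | A (i, j)) z i j * pdz i j (pfrac p)
  = pfrac (mweuler (fun u => [exists ij, A ij && (mxvec_index ij.1 ij.2 == u)]) p).
Proof.
rewrite /mweuler rmorph_sum /= [RHS]big_mkcond [RHS]sum_mxvec_index.
apply: eq_bigr => i _; rewrite big_mkcond; apply: eq_bigr => j _.
have -> : [exists ij, A ij && (mxvec_index ij.1 ij.2 == mxvec_index i j)] = A (i, j).
  apply/existsP/idP => [[[i' j'] /andP[Aij]]|Aij]; last first.
    by exists (i, j); rewrite Aij eqxx.
  by rewrite mxvec_index_inj => /andP[/eqP <- /eqP <-].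
by case: ifP => // _; rewrite /pdz /= pd_pfrac ZmxE pfracM.
Qed.

Lemma is_poly_components (A : pred ('I_2 * 'I_2)) (x : K) : is_poly x ->
  exists N (g : nat -> K), x = \sum_(k < N) g k /\
    forall k, \sum_i \sum_(j | A (i, j)) z i j * pdz i j (g k) = g k *+ k.
Proof.
move=> [p ->].
have [N [g [pg Eg]]] := mweuler_components
  (fun u => [exists ij, A ij && (mxvec_index ij.1 ij.2 == u)]) p.
exists N, (fun k => pfrac (g k)); split=> [|k]; first by rewrite pg rmorph_sum.
by rewrite pfrac_mweuler Eg rmorphMn.
Qed.

Lemma is_poly_const (x : K) : is_poly x ->
  \sum_i \sum_j z i j * pdz i j x = 0 -> exists c, x = cst c.
Proof.
move=> [p ->]; rewrite (pfrac_mweuler predT) => /eqP.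
rewrite pfrac_eq0 => /eqP Ep; exists p@_0%MM; rewrite cstE; congr pfrac.
apply/mpolyP => u; rewrite mcoeffC; case: eqP => [<-|/eqP u0].
  by rewrite mulr1.
have := congr1 (mcoeff u) Ep; rewrite mcoeff0 mcoeff_mweuler mulr0 => /eqP.
rewrite mulrn_eq0 => /orP[|/eqP //]; rewrite /mwdeg sum_nat_eq0 => /forallP u0'.
case/eqP: u0; apply/mnmP => v; rewrite mnm0E; case/mxvec_indexP: v => i j.
have := u0' (mxvec_index i j).
have -> : [exists ij : 'I_2 * 'I_2,
    predT ij && (mxvec_index ij.1 ij.2 == mxvec_index i j)].
  by apply/existsP; exists (i, j) => /=.
by move=> /eqP.
Qed.

Local Notation zf := (fun i j => z i j).
Local Notation S := (@shiftop K n pdz).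
Local Notation R := (@rowop K n zf pdz).
Local Notation L := (@colop K n zf pdz).
Local Notation Cr := (@raiseop K n zf pdz).

Lemma slotl_nabla f k I : slotl (@nabla_plus C) k f I =
  if I k == 0 then 2 * (pdz 1 1 (f (put I k 0)) - pdz 1 0 (f (put I k 1)))
  else 2 * (pdz 0 0 (f (put I k 1)) - pdz 0 1 (f (put I k 0))).
Proof.
rewrite ffunE sum_ord2 /nabla_plus !mxE /=.
by case: (ord2P (I k)) => -> /=; rewrite mulrBr // addrC.
Qed.

Lemma nat2K_neq0 : (2 : K) != 0.
Proof. by rewrite natK_eq0. Qed.

Lemma left_regularE f : left_regular f <-> regular pdz f.
Proof.
split=> [Lf k I c|Rf k].
  (* The equation for row c is the component of the tensor whose slot index is 1 - c. *)
  have /ffunP/(_ (put I k (if c == 1 then 0 else 1))) := Lf k.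
  rewrite slotl_nabla [RHS]ffunE putE eqxx !put_put => /eqP.
  case: (ord2P c) => -> /=; rewrite mulf_eq0 (negbTE nat2K_neq0) /= subr_eq0.
    by move=> /eqP.
  by move=> /eqP.
apply/ffunP => I; rewrite slotl_nabla [RHS]ffunE (Rf k I 0) (Rf k I 1).
have H (x : K) : 2 * (x - x) = 0 by rewrite subrr mulr0.
by case: (I k == 0); apply: H.
Qed.

Lemma FplusE f : Fplus f <-> polyregular pdz (@is_poly C) f.
Proof.
by split=> [[Sf Pf /left_regularE Rf]|[Sf Pf /left_regularE Rf]]; split.
Qed.

Lemma trDE (X : 'M[K]_2) (x : K) : trD X x = \sum_i \sum_j X i j * pdz i j x.
Proof.
apply: eq_bigr => i _; apply: eq_bigr => j _; rewrite /Dmx mxE /pdz /=.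
by case: (ord2P i) => ->; case: (ord2P j) => ->.
Qed.

Definition lincomb (A : 'M[C]_2) (G : 'I_2 -> 'I_2 -> T) : T :=
  \sum_a \sum_b scl (cst (A a b)) (G a b).

Lemma lincombE A G I : lincomb A G I = \sum_a \sum_b cst (A a b) * G a b I.
Proof.
rewrite sum_ffunE; apply: eq_bigr => a _; rewrite sum_ffunE.
by apply: eq_bigr => b _; rewrite ffunE.
Qed.

(** Entry (a, b) of each block contributes one elementary operator. The trace of C Z is absorbed by
    [raiseop], whereas the trace of D remains as a scalar. *)
Lemma pi_nlE (A B D Cm : 'M[C]_2) f : pi_nl (block_mx A B Cm D) f =
  - lincomb A (fun a b => R b a f) - lincomb B (fun a b => S a b f)
  + lincomb Cm (fun a b => Cr a b f)
  + (lincomb D (fun a b => L a b f) + scl (cst (\tr D)) f).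
Proof.
apply/ffunP => I; rewrite /pi_nl block_mxKul block_mxKur block_mxKdl block_mxKdr.
have E1 (X : 'M[K]_2) : entrywise (trD X) f I = \sum_i \sum_j X i j * pdz i j (f I).
  by rewrite ffunE trDE.
have E2 (X : 'M[K]_2) : (\sum_k slotl (mulop X) k f) I
    = \sum_k \sum_j X (I k) j * f (put I k j).
  rewrite sum_ffunE; apply: eq_bigr => k _; rewrite ffunE.
  by apply: eq_bigr => j _; rewrite /mulop mxE.
have E3 (x : K) : scale x f I = x * f I by rewrite ffunE.
have addE (g h : T) : (g + h) I = g I + h I by rewrite ffunE.
have oppE (g : T) : (- g) I = - g I by rewrite ffunE.
rewrite !(addE, oppE, E1, E2, E3).
rewrite sum_mulZmxZ sum_mulmxZ sum_mulZmx mxtrace_mulZ sum_slots_mulmxZ sum_slots_mx.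
rewrite !lincombE.
have mE (X : 'M[C]_2) a b : map_mx (@cst C) X a b = cst (X a b) by rewrite mxE.
have trE (X : 'M[C]_2) : \tr (map_mx (@cst C) X) = cst (\tr X).
  by rewrite /mxtrace rmorph_sum; apply: eq_bigr => i _; rewrite mxE.
rewrite trE.
have AE : \sum_a \sum_b map_mx (@cst C) A a b * \sum_e z b e * pdz a e (f I)
  = \sum_a \sum_b cst (A a b) * R b a f I.
  by apply: eq_bigr => a _; apply: eq_bigr => b _; rewrite mE ffunE.
have BE : \sum_a \sum_b map_mx (@cst C) B a b * pdz a b (f I)
  = \sum_a \sum_b cst (B a b) * S a b f I.
  by apply: eq_bigr => a _; apply: eq_bigr => b _; rewrite mE ffunE.
have CE : \sum_a \sum_b cst (Cm a b) * Cr a b f I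
  = \sum_a \sum_b map_mx (@cst C) Cm a b *
      (\sum_i z i a * \sum_j z b j * pdz i j (f I))
  + (\sum_a \sum_b map_mx (@cst C) Cm a b * z b a) * f I
  + \sum_a \sum_b map_mx (@cst C) Cm a b *
      (\sum_(k | I k == a) \sum_j z b j * f (put I k j)).
  rewrite mulr_suml -!big_split; apply: eq_bigr => a _ /=.
  rewrite mulr_suml -!big_split; apply: eq_bigr => b _ /=.
  by rewrite mE ffunE !mulrDr mulrA.
have DE : \sum_a \sum_b cst (D a b) * L a b f I
  = \sum_a \sum_b map_mx (@cst C) D a b * (\sum_e z e a * pdz e b (f I))
  + \sum_a \sum_b map_mx (@cst C) D a b * (\sum_(k | I k == a) f (put I k b)).
  rewrite -big_split; apply: eq_bigr => a _ /=.
  rewrite -big_split; apply: eq_bigr => b _ /=.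
  by rewrite mE ffunE mulrDr.
rewrite AE BE CE DE; congr (_ + _).
by rewrite addrAC.
Qed.

Lemma scl0 f : scl (cst (0 : C)) f = 0.
Proof. by apply/ffunP => I; rewrite !ffunE rmorph0 mul0r. Qed.

Lemma lincomb0 G : lincomb 0 G = 0.
Proof.
rewrite /lincomb big1 // => a _; rewrite big1 // => b _.
by rewrite mxE scl0.
Qed.

Lemma lincombN A G : lincomb (- A) G = - lincomb A G.
Proof.
apply/ffunP => I; rewrite ffunE !lincombE -sumrN; apply: eq_bigr => a _.
by rewrite -sumrN; apply: eq_bigr => b _; rewrite mxE rmorphN mulNr.
Qed.

Lemma lincombD A B G : lincomb (A + B) G = lincomb A G + lincomb B G.
Proof.
apply/ffunP => I; rewrite ffunE !lincombE -big_split; apply: eq_bigr => a _ /=.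
by rewrite -big_split; apply: eq_bigr => b _; rewrite mxE rmorphD mulrDl.
Qed.

Lemma lincomb_delta a b G : lincomb (delta_mx a b) G = G a b.
Proof.
apply/ffunP => I; rewrite lincombE (bigD1 a) //= (bigD1 b) //= big1.
  rewrite big1 => [|i ia]; first by rewrite mxE !eqxx rmorph1 mul1r !addr0.
  by rewrite big1 // => j _; rewrite mxE (negbTE ia) rmorph0 mul0r.
by move=> j jb; rewrite mxE (negbTE jb) andbF rmorph0 mul0r.
Qed.

Lemma pi_nl_shift a b f :
  pi_nl (block_mx 0 (delta_mx a b + delta_mx b a) 0 0) f = - (S a b f + S b a f).
Proof.
rewrite pi_nlE !lincomb0 lincombD !lincomb_delta mxtrace0 scl0.
by rewrite oppr0 !addr0 add0r.
Qed.

Lemma pi_nl_raise a b f :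
  pi_nl (block_mx 0 0 (delta_mx a b + delta_mx b a) 0) f = Cr a b f + Cr b a f.
Proof.
rewrite pi_nlE !lincomb0 lincombD !lincomb_delta mxtrace0 scl0.
by rewrite oppr0 !addr0 add0r.
Qed.

Lemma pi_nl_levi a b f :
  pi_nl (block_mx (delta_mx a b) 0 0 (- (delta_mx a b)^T)) f
  = - (R b a f + L b a f) - scl (cst (\tr (delta_mx a b : 'M[C]_2))) f.
Proof.
have trE : \tr (- (delta_mx a b)^T) = - \tr (delta_mx a b : 'M[C]_2).
  by rewrite raddfN /= mxtrace_tr.
rewrite pi_nlE trE !lincomb0 lincombN trmx_delta !lincomb_delta !addr0 oppr0 addr0.
rewrite opprD addrA; congr (_ + _).
by apply/ffunP => I; rewrite !ffunE rmorphN mulNr.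
Qed.

Lemma sp4_shift a b : sp4 (block_mx 0 (delta_mx a b + delta_mx b a : 'M[C]_2) 0 0).
Proof.
exists 0, (delta_mx a b + delta_mx b a), 0; rewrite !linear0.
by split=> //; rewrite linearD /= !trmx_delta addrC.
Qed.

Lemma sp4_raise a b : sp4 (block_mx 0 0 (delta_mx a b + delta_mx b a : 'M[C]_2) 0).
Proof.
exists 0, 0, (delta_mx a b + delta_mx b a); rewrite !linear0.
by split=> //; rewrite linearD /= !trmx_delta addrC.
Qed.

Lemma sp4_levi a b : sp4 (block_mx (delta_mx a b : 'M[C]_2) 0 0 (- (delta_mx a b)^T)).
Proof. by exists (delta_mx a b), 0, 0; rewrite !linear0. Qed.

Hypothesis n_gt0 : (0 < n)%N.

Lemma pd_leibniz i j (x y : K) : pdz i j (x * y) = pdz i j x * y + x * pdz i j y.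
Proof. exact: pdM. Qed.

Lemma pd_coord i j k l : pdz i j (z k l) = ((i == k) && (j == l))%:R.
Proof. exact: pd_z. Qed.

Lemma pd_comm i j k l (x : K) : pdz i j (pdz k l x) = pdz k l (pdz i j x).
Proof. exact: pdC. Qed.

Lemma pd_const (c : C) i j : pdz i j (cst c) = 0.
Proof. exact: pd_cst. Qed.

Local Notation Fp := (@polyregular K n pdz (@is_poly C)).

Lemma subspace_linear (V : T -> Prop) :
  subspace V <-> linear_space (@cst C) V.
Proof.
split=> [[V0 VL]|[V0 VD VZ]].
  have VD f g : V f -> V g -> V (f + g).
    move=> Vf Vg; have := VL 1 f g Vf Vg; congr V.
    by apply/ffunP => I; rewrite !ffunE rmorph1 mul1r.
  split=> // c f Vf; have := VL c f 0 Vf V0; congr V.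
  by rewrite addr0.
by split=> // c f g Vf Vg; apply: VD (VZ c f Vf) Vg.
Qed.

Lemma linear_space_Fplus : linear_space (@cst C) Fp.
Proof.
exact: (linear_space_polyregular n pd_leibniz pd_const is_polyC is_polyD
  is_polyM).
Qed.

Lemma linear_sum_closed (V : T -> Prop) (J : finType) (G : J -> T) :
  linear_space (@cst C) V -> (forall u, V (G u)) -> V (\sum_u G u).
Proof. by move=> [V0 VD _] VG; apply: big_ind. Qed.

Lemma linear_lincomb (V : T -> Prop) A (G : 'I_2 -> 'I_2 -> T) :
  linear_space (@cst C) V -> (forall a b, V (G a b)) -> V (lincomb A G).
Proof.
move=> linV VG; do 2!(apply: linear_sum_closed => // ?).
by case: linV => _ _; apply.
Qed.

Lemma pi_nl_polyregular X f : Fp f -> Fp (pi_nl X f).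
Proof.
move=> Ff; rewrite -[X]submxK pi_nlE; have linF := linear_space_Fplus.
have [F0 FD FZ] := linF.
have FN g : Fp g -> Fp (- g) by exact: (linN linF).
have dM := pd_leibniz; have dz' := pd_coord; have dC := pd_comm.
have pC := is_polyC; have pD := is_polyD; have pM := is_polyM.
have pz := is_poly_z; have pd' := is_poly_pd.
have FL A G : (forall a b, Fp (G a b)) -> Fp (lincomb A G).
  exact: linear_lincomb.
apply: (FD _ _ (FD _ _ (FD _ _ (FN _ (FL _ _ _)) (FN _ (FL _ _ _))) (FL _ _ _))
  (FD _ _ (FL _ _ _) (FZ _ _ Ff))) => a b.
- exact: (polyregular_row dM dz' dC pC pD pM pz pd').
- exact: (polyregular_shift dC pd').
- exact: (polyregular_raise dM dz' dC pC pD pM pz pd').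
- exact: (polyregular_col dM dz' dC pC pD pM pz pd').
Qed.

Lemma irreducible_Fplus : irreducible (@sp4 C) (@pi_nl C n) (@Fplus C n).
Proof.
have linF := linear_space_Fplus; split.
- split=> [|X f _ /FplusE Ff]; last by apply/FplusE; apply: pi_nl_polyregular.
  have /subspace_linear[F0 FL] := linF.
  split=> [|c f g /FplusE Ff /FplusE Fg]; apply/FplusE => //.
  exact: FL.
- exists [ffun=> cst 1]; split; last first.
    move/ffunP/(_ [ffun=> 0]); rewrite !ffunE => /eqP.
    by rewrite fmorph_eq0 oner_eq0.
  apply/FplusE; split=> [s I|I|k I c]; rewrite !ffunE //; first exact: is_polyC.
  by rewrite !pd_const.
move=> W [/subspace_linear linW actW] WF.
have [_ _ WZ] := linW; have [_ WD _] := linW.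
have Wshift a b f : W f -> W (S a b f + S b a f).
  move/(actW _ f (sp4_shift a b)); rewrite pi_nl_shift => /(linN linW).
  by rewrite opprK.
have Wraise a b f : W f -> W (Cr a b f + Cr b a f).
  by move/(actW _ f (sp4_raise a b)); rewrite pi_nl_raise.
have Wlevi a b f : W f -> W (R b a f + L b a f).
  move=> Wf; have := actW _ f (sp4_levi a b) Wf.
  (* The scalar tr A left over from D = - A^T is cancelled by adding a multiple of f, which lies in
     [W]. *)
  rewrite pi_nl_levi => H; have := WD _ _ H (WZ (\tr (delta_mx a b)) _ Wf).
  by rewrite subrK => /(linN linW); rewrite opprK.
have [[f Wf]|W0] := pselect (exists f, W f /\ f <> 0).
  right=> g /FplusE Fg.
  apply: (submodule_full n_gt0 pd_leibniz pd_coord pd_comm pd_const is_polyC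
           is_polyD is_polyM is_poly_z is_poly_pd is_poly_components
           is_poly_const linW _ Wshift Wraise Wlevi) => //.
    by move=> h /WF /FplusE.
  by exists f.
left=> f Wf; apply/eqP; apply: contraPT isT => /eqP f0 _.
by apply: W0; exists f.
Qed.

End LeftRegularPolynomials.

(** * Transport by inversion and transposition *)

Section TensorProducts.
Variables (K : comNzRingType) (n : nat).
Local Notation idx := {ffun 'I_n -> 'I_2}.
Local Notation T := {ffun idx -> K}.
Implicit Types (f g : T) (I J : idx) (k l : 'I_n) (X Y : 'I_n -> 'M[K]_2).

(* The action of [X_0 (x) ... (x) X_(n-1)]. *)
Definition tmul X f : T :=
  [ffun I : idx => \sum_(J : idx) (\prod_k X k (I k) (J k)) * f J].

(** With N = 1 this is M acting in slot k; with M the derivative of N it is one term of the Leibniz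
    rule for the n-th tensor power of N. *)
Definition at_slot (M N : 'M[K]_2) k l := if l == k then M else N.

Lemma eq_tmul X Y f : (forall k, X k = Y k) -> tmul X f = tmul Y f.
Proof.
move=> XY; apply/ffunP => I; rewrite !ffunE; apply: eq_bigr => J _.
by congr (_ * _); apply: eq_bigr => k _; rewrite XY.
Qed.

Lemma tmulM X Y f : tmul X (tmul Y f) = tmul (fun k => X k *m Y k) f.
Proof.
apply/ffunP => I; rewrite !ffunE.
transitivity (\sum_(J : idx) \sum_(J' : idx) \prod_k X k (I k) (J k) *
    ((\prod_k Y k (J k) (J' k)) * f J')).
  by apply: eq_bigr => J _; rewrite ffunE mulr_sumr.
rewrite exchange_big /=; apply: eq_bigr => J' _.
under eq_bigr => J _ do rewrite mulrA -big_split /=.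
rewrite -mulr_suml; congr (_ * _).
under [RHS]eq_bigr => k _ do rewrite mxE.
by rewrite bigA_distr_bigA.
Qed.

Lemma prod_id I J : \prod_k (1%:M : 'M[K]_2) (I k) (J k) = (I == J)%:R.
Proof.
case: eqP => [->|IJ]; first by rewrite big1 // => k _; rewrite mxE eqxx.
have [k IJk] : exists k, I k != J k.
  apply/existsP; rewrite -[X in is_true X]negbK negb_exists; apply/negP => /forallP H.
  by apply: IJ; apply/ffunP => k; have := H k; rewrite negbK => /eqP.
by rewrite (bigD1 k) //= mxE (negbTE IJk) mul0r.
Qed.

Lemma tmul1 f : tmul (fun=> 1%:M) f = f.
Proof.
apply/ffunP => I; rewrite ffunE (bigD1 I) //= prod_id eqxx mul1r big1 ?addr0 //.
by move=> J JI; rewrite prod_id eq_sym (negbTE JI) mul0r.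
Qed.

Lemma tmul_slot M k f :
  tmul (at_slot M 1%:M k) f = [ffun I : idx => \sum_j M (I k) j * f (put I k j)].
Proof.
apply/ffunP => I; rewrite !ffunE (partition_big (fun J : idx => J k) predT) //=.
apply: eq_bigr => j _.
have split_k J : \prod_l at_slot M 1%:M k l (I l) (J l)
    = M (I k) (J k) * (put I k (J k) == J)%:R.
  rewrite -prod_id (bigD1 k) //= /at_slot eqxx; congr (_ * _).
  rewrite [RHS](bigD1 k) //= putE eqxx mxE eqxx mul1r.
  by apply: eq_bigr => l /negbTE lk; rewrite putE lk.
rewrite (bigD1 (put I k j)) /=; last by rewrite putE eqxx.
rewrite split_k putE eqxx eqxx mulr1 big1 ?addr0 // => J /andP[/eqP <- JI].
by rewrite split_k eq_sym (negbTE JI) mulr0 mul0r.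
Qed.

Lemma tmulD X f g : tmul X (f + g) = tmul X f + tmul X g.
Proof.
apply/ffunP => I; rewrite !ffunE -big_split; apply: eq_bigr => J _.
by rewrite ffunE mulrDr.
Qed.

Lemma tmulZ X x f : tmul X (scl x f) = scl x (tmul X f).
Proof.
apply/ffunP => I; rewrite !ffunE mulr_sumr; apply: eq_bigr => J _.
by rewrite ffunE mulrCA.
Qed.

Lemma map_tmul (s : {rmorphism K -> K}) X f :
  [ffun I : idx => s (tmul X f I)]
  = tmul (fun k => map_mx s (X k)) [ffun I : idx => s (f I)].
Proof.
apply/ffunP => I; rewrite !ffunE rmorph_sum; apply: eq_bigr => J _.
rewrite rmorphM rmorph_prod ffunE; congr (_ * _).
by apply: eq_bigr => k _; rewrite mxE.
Qed.

Section Derivation.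
Variable D : {additive K -> K}.
Hypothesis DM : forall x y, D (x * y) = D x * y + x * D y.

Lemma derivation_prod (J : eqType) (r : seq J) (F : J -> K) : uniq r ->
  D (\prod_(k <- r) F k)
  = \sum_(k <- r) \prod_(l <- r) (if l == k then D (F l) else F l).
Proof.
elim: r => [_|k r IHr] /=.
  by rewrite !big_nil; have := DM 1 1; rewrite !mulr1 mul1r -[LHS]addr0 => /addrI.
move=> /andP[kr ur]; rewrite !big_cons DM IHr // eqxx; congr (_ * _ + _).
  apply: eq_big_seq => l lr; case: eqP => // lk.
  by move: kr; rewrite -lk lr.
rewrite mulr_sumr; apply: eq_big_seq => l lr; rewrite big_cons.
by case: eqP => // kl; move: kr; rewrite kl lr.
Qed.

Lemma derivation_tmul M f I : D (tmul (fun=> M) f I)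
  = tmul (fun=> M) [ffun J : idx => D (f J)] I
    + \sum_k tmul (at_slot (map_mx D M) M k) f I.
Proof.
rewrite [in LHS]ffunE raddf_sum [tmul _ _ I]ffunE.
under [X in _ = _ + X]eq_bigr => k _ do rewrite ffunE.
rewrite exchange_big -big_split; apply: eq_bigr => J _ /=.
rewrite DM addrC ffunE; congr (_ + _).
rewrite derivation_prod ?index_enum_uniq // mulr_suml.
apply: eq_bigr => k _; congr (_ * _); apply: eq_bigr => l _.
by rewrite /at_slot; case: (l == k); rewrite ?mxE.
Qed.

End Derivation.
End TensorProducts.

(** * Transport of irreducibility along a twisted involution *)

Section Transfer.
Variables (C : fieldType) (n : nat).
Local Notation T := (tens C n).

(** Submodules of V' correspond to submodules of V by taking preimages under [phi]. As [theta] is an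
    involution of L, letting X run through L or [theta X] does makes no difference to stability. *)
Lemma irreducible_transfer (L : 'M[C]_(2 + 2) -> Prop)
    (act act' : 'M[C]_(2 + 2) -> T -> T) (V V' : T -> Prop)
    (phi : T -> T) (theta : 'M[C]_(2 + 2) -> 'M[C]_(2 + 2)) :
  involutive phi -> {morph phi : f g / f + g} ->
  (forall c f, phi (scale (cst c) f) = scale (cst c) (phi f)) ->
  (forall X, L X -> L (theta X)) -> (forall X, L X -> theta (theta X) = X) ->
  (forall X f, L X -> act' X (phi f) = phi (act (theta X) f)) ->
  (forall f, V' f <-> V (phi f)) ->
  irreducible L act V -> irreducible L act' V'.
Proof.
move=> phiK phiD phiZ Lt tK actE VE [[[V0 VL] Vact] [f [Vf f0]] irr].
have phi0 : phi 0 = 0 by apply: (addrI (phi 0)); rewrite -phiD !addr0.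
have phiL c g h : phi (scale (cst c) g + h) = scale (cst c) (phi g) + phi h.
  by rewrite phiD phiZ.
split.
- split; first split; first by apply/VE; rewrite phi0.
    by move=> c g h /VE Vg /VE Vh; apply/VE; rewrite phiL; apply: VL.
  move=> X g LX /VE Vg; apply/VE; rewrite -[g]phiK actE // phiK.
  by apply: Vact => //; apply: Lt.
- exists (phi f); split; first by apply/VE; rewrite phiK.
  by move=> pf0; apply: f0; rewrite -[f]phiK pf0.
move=> W [[W0 WL] Wact] WV'.
have [||Wz|Wf] := irr (fun g => W (phi g)).
- split; first split; first by rewrite phi0.
    by move=> c g h Wg Wh; rewrite phiL; apply: WL.
  move=> X g LX Wg; rewrite -(tK X LX) -actE; last exact: Lt.
  by apply: Wact => //; apply: Lt.
- by move=> g /WV' /VE; rewrite phiK.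
- by left=> g Wg; rewrite -[g]phiK [phi g]Wz ?phi0 // phiK.
- by right=> g /VE /Wf; rewrite phiK.
Qed.

End Transfer.

(** * Identities for matrices of size two *)

Section Matrix2.
Variable F : comNzRingType.
Implicit Types (M N X W : 'M[F]_2) (G : 'I_2 -> 'I_2 -> F).

Lemma det_mx2 M : \det M = M 0 0 * M 1 1 - M 0 1 * M 1 0.
Proof.
rewrite (expand_det_row _ 0) sum_ord2 /cofactor !det_mx11 !mxE /=.
have -> : lift 0 0 = 1 :> 'I_2 by apply: val_inj.
have -> : lift 1 0 = 0 :> 'I_2 by apply: val_inj.
by rewrite expr0 expr1 mul1r mulN1r mulrN.
Qed.

Lemma mulmx_delta M N i j k l : (M *m delta_mx i j *m N) k l = M k i * N j l.
Proof.
rewrite !mxE (bigD1 j) //= mxE (bigD1 i) //= mxE !eqxx mulr1.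
rewrite big1 => [|a ai]; last by rewrite mxE (negbTE ai) mulr0.
rewrite addr0 big1 ?addr0 // => b bj; rewrite mxE big1 ?mul0r // => a _.
by rewrite mxE (negbTE bj) andbF mulr0.
Qed.

(** For W = Z^-1 the factor -(W_ki W_jl) is the derivative of W_kl by z_ij. This identity and the
    next two are its contractions, needed for the Jacobian, the pullback of vector fields and the
    derivative of W. *)
Lemma sum_jacobian M W i j : \sum_k \sum_l M k l * - (W k i * W j l)
  = - (W^T *m M *m W^T) i j.
Proof. by rewrite !(sum_ord2, mxE); ring. Qed.

Lemma sum_pullback X W G :
  \sum_i \sum_j X i j * (\sum_k \sum_l G k l * - (W k i * W j l))
  = - \sum_k \sum_l (W *m X *m W) k l * G k l.
Proof. by rewrite !(sum_ord2, mxE); ring. Qed.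

Lemma sum_conj X W k l : \sum_i \sum_j X i j * - (W k i * W j l)
  = - (W *m X *m W) k l.
Proof. by rewrite !(sum_ord2, mxE); ring. Qed.

End Matrix2.

Lemma inverse_rule (F : fieldType) (x t a : F) :
  x != 0 -> 0 = t * x * x^-1 + x * a -> a = - (t * x^-1).
Proof.
move=> x0 E; apply: (mulfI x0); rewrite mulrN mulrCA mulfV // mulr1.
by apply/eqP; rewrite -addr_eq0 addrC -[X in X + _](mulfK x0) -E.
Qed.

(** * Inversion and transposition as automorphisms of the fraction field *)

Section Substitutions.
Variable C : numFieldType.
Local Notation P := (zpoly C).
Local Notation K := (zfrac C).
Local Notation z := (@Zmx C).
Local Notation w := (invmx z).
Implicit Types (x y : K) (i j k l : 'I_2) (X Y : 'M[K]_2).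

Lemma rmorph_frac_ext (s t : {rmorphism K -> K}) :
  (forall c, s (cst c) = t (cst c)) -> (forall i j, s (z i j) = t (z i j)) ->
  forall x, s x = t x.
Proof.
move=> stC stz.
have stP p : s (pfrac p) = t (pfrac p).
  elim/mpoly_ring_ind: p => [c|u|p q Ep Eq|p q Ep Eq].
  - by rewrite -cstE stC.
  - by case/mxvec_indexP: u => i j; rewrite -ZmxE.
  - by rewrite pfracD !rmorphD /= Ep Eq.
  - by rewrite pfracM !rmorphM /= Ep Eq.
by move=> x; have [p [q [_ ->]]] := frac_rep x; rewrite !fmorph_div /= !stP.
Qed.

Lemma NzE : Nz C = z 0 0 * z 1 1 - z 0 1 * z 1 0.
Proof. exact: det_mx2. Qed.

Lemma pd_NzE i j : pd i j (Nz C) =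
  ((i == 0) && (j == 0))%:R * z 1 1 + z 0 0 * ((i == 1) && (j == 1))%:R
  - (((i == 0) && (j == 1))%:R * z 1 0 + z 0 1 * ((i == 1) && (j == 0))%:R).
Proof. by rewrite NzE pdD pdN !pdM !pd_z. Qed.

(** Differentiating the determinant by z_00 and then by z_11 gives 1. *)
Lemma Nz_neq0 : Nz C != 0.
Proof.
apply/eqP => N0; have := congr1 (fun x => pd 1 1 (pd 0 0 x)) N0.
rewrite pd_NzE /= mul1r mulr0 mul0r mulr0 !addr0 subr0 pd_z /= !pd0.
by move/eqP; rewrite oner_eq0.
Qed.

Lemma unitZ : z \in unitmx.
Proof. by rewrite unitmxE unitfE Nz_neq0. Qed.

(** Jacobi's formula: the derivatives of the determinant form the adjugate matrix, here identified
    by multiplying with Z. *)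
Lemma pd_Nz i j : pd i j (Nz C) = Nz C * w j i.
Proof.
pose c := \matrix_(j, i) pd i j (Nz C).
have zc : z *m c = (Nz C)%:M.
  apply/matrixP => a b; rewrite [LHS]mxE sum_ord2 ![c _ _]mxE !pd_NzE [RHS]mxE NzE.
  by case: (ord2P a) => ->; case: (ord2P b) => -> /=;
    rewrite ?(mulr1n, mulr0n); ring.
have : c = Nz C *: w.
  by rewrite -[c](mulKmx unitZ) zc mul_mx_scalar.
by move/matrixP/(_ j i); rewrite !mxE.
Qed.

(** Obtained by differentiating Z Z^-1 = 1. *)
Lemma pd_w i j k l : pd i j (w k l) = - (w k i * w j l).
Proof.
pose Dw := map_mx (pd i j) w.
have E : delta_mx i j *m w + z *m Dw = 0.
  apply/matrixP => a b.
  have H : pd i j ((z *m w) a b) = 0 by rewrite mulmxV ?unitZ // mxE -cst_nat pd_cst.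
  rewrite [RHS]mxE -H [(z *m w) a b]mxE raddf_sum.
  rewrite [LHS]mxE [(delta_mx _ _ *m w) a b]mxE [(z *m Dw) a b]mxE -big_split.
  apply: eq_bigr => m _ /=.
  by rewrite pdM pd_z ![delta_mx _ _ _ _]mxE ![Dw _ _]mxE (eq_sym a) (eq_sym m).
have DwE : Dw = - (w *m delta_mx i j *m w).
  apply/eqP; rewrite -addr_eq0 -mulmxA -[Dw](mulKmx unitZ) -mulmxDr addrC E.
  by rewrite mulmx0.
have := congr1 (fun M : 'M_2 => M k l) DwE.
by rewrite [LHS]mxE [RHS]mxE mulmx_delta.
Qed.

Lemma jacobian_tr (M : 'M[K]_2) :
  (forall i j, \sum_k \sum_l M k l * pd i j (z^T k l) = 0) -> M = 0.
Proof.
move=> H; apply/matrixP => k l; rewrite [RHS]mxE -(H l k).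
rewrite (bigD1 k) //= (bigD1 l) //= big1 => [|b bl]; last first.
  by rewrite [z^T _ _]mxE pd_z (eq_sym l) (negbTE bl) mulr0.
rewrite big1 => [|a ak]; last first.
  rewrite big1 // => b _.
  by rewrite [z^T _ _]mxE pd_z (eq_sym k) (negbTE ak) andbF mulr0.
by rewrite [z^T _ _]mxE pd_z !eqxx mulr1 !addr0.
Qed.

(** By [pd_w] the assumption reads W^T M W^T = 0 for W = Z^-1, and W^T is invertible. *)
Lemma jacobian_inv (M : 'M[K]_2) :
  (forall i j, \sum_k \sum_l M k l * pd i j (w k l) = 0) -> M = 0.
Proof.
move=> H; have uw : w^T \in unitmx by rewrite unitmx_tr unitmx_inv unitZ.
have E : w^T *m M *m w^T = 0.
  apply/matrixP => i j; rewrite [RHS]mxE -[LHS]opprK -sum_jacobian -[RHS]oppr0.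
  rewrite -[in RHS](H i j); congr (- _).
  by apply: eq_bigr => k _; apply: eq_bigr => l _; rewrite pd_w.
by rewrite -[M](mulKmx uw) -[w^T *m M](mulmxK uw) E mul0mx mulmx0.
Qed.

Definition tau : K -> K := zsubst z^T.
HB.instance Definition _ := GRing.isNmodMorphism.Build K K tau
  (zsubst_nmod_morphism jacobian_tr).
HB.instance Definition _ := GRing.isMonoidMorphism.Build K K tau
  (zsubst_monoid_morphism jacobian_tr).

Definition sigma : K -> K := zsubst w.
HB.instance Definition _ := GRing.isNmodMorphism.Build K K sigma
  (zsubst_nmod_morphism jacobian_inv).
HB.instance Definition _ := GRing.isMonoidMorphism.Build K K sigma
  (zsubst_monoid_morphism jacobian_inv).

Lemma tau_cst c : tau (cst c) = cst c.
Proof. exact: zsubst_cst jacobian_tr c. Qed.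

Lemma sigma_cst c : sigma (cst c) = cst c.
Proof. exact: zsubst_cst jacobian_inv c. Qed.

Lemma tau_z i j : tau (z i j) = z j i.
Proof. by rewrite /tau (zsubst_z jacobian_tr) mxE. Qed.

Lemma sigma_z i j : sigma (z i j) = w i j.
Proof. exact: zsubst_z jacobian_inv i j. Qed.

Lemma map_tauZ : map_mx tau z = z^T.
Proof. by apply/matrixP => i j; rewrite mxE [RHS]mxE tau_z. Qed.

Lemma map_sigmaZ : map_mx sigma z = w.
Proof. by apply/matrixP => i j; rewrite mxE sigma_z. Qed.

Lemma map_sigma_w : map_mx sigma w = z.
Proof. by rewrite map_invmx map_sigmaZ invmxK. Qed.

Lemma map_tau_w : map_mx tau w = w^T.
Proof. by rewrite map_invmx map_tauZ trmx_inv. Qed.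

Lemma tauK : involutive tau.
Proof.
apply: (@rmorph_frac_ext (tau \o tau) idfun) => [c|i j] /=.
  by rewrite !tau_cst.
by rewrite !tau_z.
Qed.

Lemma sigmaK : involutive sigma.
Proof.
apply: (@rmorph_frac_ext (sigma \o sigma) idfun) => [c|i j] /=.
  by rewrite !sigma_cst.
by rewrite sigma_z -[RHS](congr1 (fun M : 'M_2 => M i j) map_sigma_w) [RHS]mxE.
Qed.

Lemma sigma_tau x : sigma (tau x) = tau (sigma x).
Proof.
apply: (@rmorph_frac_ext (sigma \o tau) (tau \o sigma)) => [c|i j] /=.
  by rewrite tau_cst !sigma_cst tau_cst.
rewrite tau_z !sigma_z.
by have := congr1 (fun M : 'M_2 => M i j) map_tau_w; rewrite [LHS]mxE [RHS]mxE.
Qed.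

Lemma sigma_Nz : sigma (Nz C) = (Nz C)^-1.
Proof. by rewrite /Nz -det_map_mx map_sigmaZ det_inv. Qed.

Lemma tau_Nz : tau (Nz C) = Nz C.
Proof. by rewrite /Nz -det_map_mx map_tauZ det_tr. Qed.

Lemma pd_tau i j x : pd i j (tau x) = tau (pd j i x).
Proof.
rewrite /tau (pd_zsubst jacobian_tr) (bigD1 j) //= (bigD1 i) //=.
rewrite big1 => [|b bi]; last first.
  by rewrite [z^T _ _]mxE pd_z (eq_sym i) (negbTE bi) mulr0.
rewrite big1 => [|a aj]; last first.
  rewrite big1 // => b _.
  by rewrite [z^T _ _]mxE pd_z (eq_sym j) (negbTE aj) andbF mulr0.
by rewrite [z^T _ _]mxE pd_z !eqxx mulr1 !addr0.
Qed.

Lemma pd_sigma i j x : pd i j (sigma x)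
  = \sum_k \sum_l sigma (pd k l x) * - (w k i * w j l).
Proof.
rewrite /sigma (pd_zsubst jacobian_inv).
by apply: eq_bigr => k _; apply: eq_bigr => l _; rewrite pd_w.
Qed.

Lemma trD_pd X x : trD X x = \sum_i \sum_j X i j * pd i j x.
Proof. exact: trDE. Qed.

(** Since dW = - W dZ W for W = Z^-1, inversion carries a vector field with matrix X to the one with
    matrix - Z sigma(X) Z. *)
Lemma trD_sigma X x :
  trD X (sigma x) = - sigma (trD (z *m map_mx sigma X *m z) x).
Proof.
rewrite !trD_pd rmorph_sum; under eq_bigr => i _ do
  under eq_bigr => j _ do rewrite pd_sigma.
rewrite sum_pullback; congr (- _); apply: eq_bigr => k _; rewrite rmorph_sum.
apply: eq_bigr => l _; rewrite [RHS]rmorphM; congr (_ * _).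
transitivity (map_mx sigma (z *m map_mx sigma X *m z) k l); last by rewrite mxE.
rewrite !map_mxM map_sigmaZ; congr ((_ *m _ *m _) k l).
by apply/matrixP => a b; rewrite !mxE /= sigmaK.
Qed.

Lemma trD_tau X x : trD X (tau x) = tau (trD (map_mx tau X)^T x).
Proof.
rewrite !trD_pd exchange_big rmorph_sum; apply: eq_bigr => j _.
rewrite rmorph_sum; apply: eq_bigr => i _ /=; rewrite [RHS]rmorphM; congr (_ * _).
  by rewrite !mxE /= tauK.
exact: pd_tau.
Qed.

Lemma trD_nmod_morphism X : nmod_morphism (trD X).
Proof.
split=> [|x y].
  rewrite trD_pd big1 // => i _; rewrite big1 // => j _.
  by rewrite pd0 mulr0.
rewrite !trD_pd -big_split; apply: eq_bigr => i _ /=.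
by rewrite -big_split; apply: eq_bigr => j _ /=; rewrite pdD mulrDr.
Qed.

HB.instance Definition _ X := GRing.isNmodMorphism.Build K K (trD X)
  (trD_nmod_morphism X).

Lemma trDM X x y : trD X (x * y) = trD X x * y + x * trD X y.
Proof.
rewrite !trD_pd mulr_suml mulr_sumr -big_split; apply: eq_bigr => i _ /=.
rewrite mulr_suml mulr_sumr -big_split; apply: eq_bigr => j _ /=.
by rewrite pdM mulrDr mulrA [X in _ + X]mulrCA.
Qed.

Lemma map_trD_w X : map_mx (trD X) w = - (w *m X *m w).
Proof.
apply/matrixP => k l; rewrite mxE trD_pd [RHS]mxE -sum_conj.
by apply: eq_bigr => i _; apply: eq_bigr => j _; rewrite pd_w.
Qed.

Lemma trD_Nz X : trD X (Nz C)^-1 = - (\tr (X *m w) * (Nz C)^-1).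
Proof.
have E : trD X (Nz C) = \tr (X *m w) * Nz C.
  rewrite trD_pd mxtrace_mulZ mulr_suml; apply: eq_bigr => i _.
  rewrite mulr_suml; apply: eq_bigr => j _.
  by rewrite pd_Nz [Nz C * _]mulrC mulrA.
have E1 : trD X 1 = 0.
  by have := trDM X 1 1; rewrite !mulr1 mul1r -[LHS]addr0 => /addrI.
have := trDM X (Nz C) (Nz C)^-1; rewrite (mulfV Nz_neq0) E1 E.
exact: inverse_rule Nz_neq0.
Qed.

End Substitutions.

Lemma invl_arith (F : comNzRingType) (N t a b c : F) :
  - (t * N) * a + N * (b + c) = - (N * - b + t * (N * a) + N * - c).
Proof. by ring. Qed.

(** * The inversion of tensor-valued functions *)

Section Inversion.
Variables (C : numFieldType) (n : nat).
Local Notation K := (zfrac C).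
Local Notation z := (@Zmx C).
Local Notation w := (invmx z).
Local Notation idx := {ffun 'I_n -> 'I_2}.
Local Notation T := (tens C n).
Local Notation sg := (@sigma C).
Implicit Types (f g : T) (I J : idx) (x : K) (X Y : 'M[K]_2) (k : 'I_n).

Lemma invlE f : invl f = scl (Nz C)^-1 (tmul (fun=> w) (entrywise sg f)).
Proof. by []. Qed.

Lemma slotlE X k f : slotl (mulop X) k f = tmul (at_slot X 1%:M k) f.
Proof.
rewrite tmul_slot; apply/ffunP => I; rewrite !ffunE.
by apply: eq_bigr => j _; rewrite mxE.
Qed.

Lemma entrywise_tmul (M : 'I_n -> 'M[K]_2) f :
  entrywise sg (tmul M f) = tmul (fun k => map_mx sg (M k)) (entrywise sg f).
Proof. exact: (map_tmul (@sigma C : {rmorphism K -> K}) M f). Qed.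

Lemma entrywise_scl x f :
  entrywise sg (scl x f) = scl (sg x) (entrywise sg f).
Proof. by apply/ffunP => I; rewrite !ffunE rmorphM. Qed.

Lemma scl_scl x y f : scl x (scl y f) = scl (x * y) f.
Proof. by apply/ffunP => I; rewrite !ffunE mulrA. Qed.

(** The automorphism [sigma] sends N to N^-1 and Z^-1 to Z, so the factors of the two applications
    cancel. *)
Lemma invlK : involutive (@invl C n).
Proof.
move=> f; rewrite !invlE entrywise_scl entrywise_tmul tmulZ tmulM scl_scl.
have -> : sg (Nz C)^-1 = Nz C by rewrite fmorphV /= sigma_Nz invrK.
rewrite (mulVf (@Nz_neq0 C)).
rewrite (@eq_tmul _ _ _ (fun=> 1%:M)) => [|k]; last first.
  by rewrite map_sigma_w mulVmx ?unitZ.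
rewrite tmul1; apply/ffunP => I; rewrite !ffunE mul1r; exact: sigmaK.
Qed.

Lemma invlD : {morph @invl C n : f g / f + g}.
Proof.
move=> f g; rewrite !invlE.
have -> : entrywise sg (f + g) = entrywise sg f + entrywise sg g.
  by apply/ffunP => I; rewrite !ffunE rmorphD.
by rewrite tmulD; apply/ffunP => I; rewrite !ffunE mulrDr.
Qed.

Lemma invl0 : invl (0 : T) = 0.
Proof. by apply: (addrI (invl 0)); rewrite -invlD !addr0. Qed.

Lemma invl_sum (r : seq 'I_n) (G : 'I_n -> T) :
  invl (\sum_(k <- r) G k) = \sum_(k <- r) invl (G k).
Proof. exact: (big_morph _ invlD invl0). Qed.

Lemma invlZ x f : invl (scale x f) = scale (sg x) (invl f).
Proof.
rewrite -[scale x f]/(scl x f) -[RHS]/(scl (sg x) (invl f)) !invlE.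
by rewrite entrywise_scl tmulZ !scl_scl mulrC.
Qed.

Lemma invl_slot Y k f : invl (slotl (mulop Y) k f)
  = slotl (mulop (w *m map_mx sg Y *m z)) k (invl f).
Proof.
rewrite !slotlE !invlE entrywise_tmul tmulZ !tmulM; congr (scl _ _).
apply: eq_tmul => l; rewrite /at_slot; case: (l == k).
  by rewrite mulmxK ?unitZ.
by rewrite map_mx1 mulmx1 mul1mx.
Qed.

Lemma slotlZ Y k x f : slotl (mulop Y) k (scl x f) = scl x (slotl (mulop Y) k f).
Proof. by rewrite !slotlE tmulZ. Qed.

(** The product rule has three sources: the factor N^-1 gives the trace term, the tensor power of
    Z^-1 gives the slot terms, and f gives the transported vector field. The first two are the
    scalar and slot terms of the C and D blocks, which explains the prefactor in [invl]. *)
Lemma trD_invl X f : entrywise (trD X) (invl f) =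
  - (invl (entrywise (trD (z *m map_mx sg X *m z)) f)
     + scale (\tr (X *m w)) (invl f)
     + \sum_k slotl (mulop (w *m X)) k (invl f)).
Proof.
pose t := tmul (fun=> w) (entrywise sg f).
have oppE (M : 'M[K]_2) i j : (- M) i j = - M i j by rewrite mxE.
have sE k : slotl (mulop (w *m X)) k t
    = - tmul (at_slot (map_mx (trD X) w) w k) (entrywise sg f).
  rewrite slotlE tmulM map_trD_w; apply/ffunP => I; rewrite !ffunE -sumrN.
  apply: eq_bigr => J _; rewrite -mulNr; congr (_ * _).
  rewrite (bigD1 k) //= [in RHS](bigD1 k) //= /at_slot !eqxx oppE mulNr opprK.
  by congr (_ * _); apply: eq_bigr => l /negbTE lk; rewrite lk mul1mx.
have tE : tmul (fun=> w) (entrywise sg (entrywise (trD (z *m map_mx sg X *m z)) f))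
    = - tmul (fun=> w) [ffun J => trD X (entrywise sg f J)].
  apply/ffunP => I; rewrite !ffunE -sumrN; apply: eq_bigr => J _.
  by rewrite !ffunE trD_sigma mulrN opprK.
have -> : \sum_k slotl (mulop (w *m X)) k (invl f)
    = scl (Nz C)^-1 (\sum_k slotl (mulop (w *m X)) k t).
  rewrite -/t; apply/ffunP => I; rewrite ffunE !sum_ffunE mulr_sumr.
  by apply: eq_bigr => k _; rewrite invlE slotlZ ffunE.
rewrite [invl (entrywise _ _)]invlE tE (eq_bigr _ (fun k _ => sE k)) sumrN.
rewrite [invl f]invlE -/t.
apply/ffunP => I; rewrite [LHS]ffunE ffunE trDM trD_Nz derivation_tmul; last first.
  exact: trDM.
rewrite !ffunE sum_ffunE.
set a := \sum_J _; set b := \sum_k _; set c := \sum_J _.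
exact: invl_arith.
Qed.
End Inversion.

Lemma addr_swap_ends (V : zmodType) (a b c d : V) :
  a + b + c + d = d + b + c + a.
Proof. by rewrite [LHS]addrC -(addrA a) [a + _]addrC !addrA. Qed.

(** * Inversion exchanges the blocks A with D and B with C *)

Section Intertwining.
Variables (C : numFieldType) (n : nat).
Local Notation K := (zfrac C).
Local Notation z := (@Zmx C).
Local Notation w := (invmx z).
Local Notation idx := {ffun 'I_n -> 'I_2}.
Local Notation T := (tens C n).
Local Notation sg := (@sigma C).
Local Notation cmx := (map_mx (@cst C)).
Implicit Types (f g : T) (I J : idx) (x : K) (X Y : 'M[K]_2) (k : 'I_n).
Implicit Types (A B D M : 'M[C]_2).

Definition blockA A f : T := - entrywise (trD (cmx A *m z)) f.
Definition blockB B f : T := - entrywise (trD (cmx B)) f.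
Definition blockC M f : T :=
  entrywise (trD (z *m cmx M *m z)) f + scale (\tr (cmx M *m z)) f
  + \sum_k slotl (mulop (cmx M *m z)) k f.
Definition blockD D f : T :=
  entrywise (trD (z *m cmx D)) f + scale (\tr (cmx D)) f
  + \sum_k slotl (mulop (cmx D)) k f.

Lemma pi_nl_blocks A B M D f : pi_nl (block_mx A B M D) f
  = blockA A f + blockB B f + blockC M f + blockD D f.
Proof. by rewrite /pi_nl block_mxKul block_mxKur block_mxKdl block_mxKdr. Qed.

Lemma map_sigma_cmx M : map_mx sg (cmx M) = cmx M.
Proof. by apply/matrixP => i j; rewrite !mxE /= sigma_cst. Qed.

(** For X = A Z, the matrix Z sigma(X) Z of [trD_invl] becomes Z A, the trace becomes tr A, and the
    slot matrix Z^-1 A Z is A conjugated as in [invl_slot]. *)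
Lemma blockA_invl A f : blockA A (invl f) = invl (blockD A f).
Proof.
rewrite /blockA trD_invl opprK /blockD !invlD invl_sum invlZ.
rewrite map_mxM map_sigma_cmx map_sigmaZ.
rewrite !mulmxA (mulmxKV (@unitZ C)) (mulmxK (@unitZ C)).
have -> : sg (\tr (cmx A)) = \tr (cmx A) by rewrite -trace_map_mx map_sigma_cmx.
congr (_ + _); apply: eq_bigr => k _.
by rewrite invl_slot map_sigma_cmx.
Qed.

Lemma blockB_invl B f : blockB B (invl f) = invl (blockC B f).
Proof.
rewrite /blockB trD_invl opprK /blockC !invlD invl_sum invlZ map_sigma_cmx.
have -> : sg (\tr (cmx B *m z)) = \tr (cmx B *m w).
  by rewrite -trace_map_mx map_mxM map_sigma_cmx map_sigmaZ.
congr (_ + _); apply: eq_bigr => k _.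
by rewrite invl_slot map_mxM map_sigma_cmx map_sigmaZ mulmxA (mulmxKV (@unitZ C)).
Qed.

Lemma blockC_invl M f : blockC M (invl f) = invl (blockB M f).
Proof. by rewrite -[LHS](@invlK C n) -blockB_invl invlK. Qed.

Lemma blockD_invl D f : blockD D (invl f) = invl (blockA D f).
Proof. by rewrite -[LHS](@invlK C n) -blockA_invl invlK. Qed.

Lemma pi_nl_invl A B M D f : pi_nl (block_mx A B M D) (invl f)
  = invl (pi_nl (block_mx D M B A) f).
Proof.
rewrite !pi_nl_blocks 3!invlD -blockD_invl -blockC_invl -blockB_invl -blockA_invl.
by rewrite [LHS]addrC [X in _ + X]addrC [X in _ + (_ + X)]addrC !addrA.
Qed.

(** * Laurent polynomials and the space F- *)

Lemma is_laurentC (c : C) : is_laurent (cst c).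
Proof. by exists c%:MP, 0%N; rewrite expr0 divr1 cstE. Qed.

Lemma NzP : exists p : zpoly C, Nz C = pfrac p.
Proof.
exists ('X_(mxvec_index 0 0) * 'X_(mxvec_index 1 1)
        - 'X_(mxvec_index 0 1) * 'X_(mxvec_index 1 0)).
by rewrite NzE rmorphB /= !pfracM -!ZmxE.
Qed.

Lemma is_laurentM x y : is_laurent x -> is_laurent y -> is_laurent (x * y).
Proof.
move=> [p [k ->]] [q [l ->]]; exists (p * q), (k + l)%N.
by rewrite mulf_div -exprD pfracM.
Qed.

Lemma is_laurentD x y : is_laurent x -> is_laurent y -> is_laurent (x + y).
Proof.
move=> [p [k ->]] [q [l ->]]; have [N NE] := NzP.
exists (p * N ^+ l + q * N ^+ k), (k + l)%N.
have Nk m : Nz C ^+ m != 0 by rewrite expf_neq0 ?Nz_neq0.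
by rewrite (addf_div _ _ (Nk k) (Nk l)) -exprD pfracD !pfracM !rmorphXn /= -NE.
Qed.

Lemma is_laurent_Nz_inv : is_laurent (Nz C)^-1.
Proof. by exists 1, 1%N; rewrite expr1 rmorph1 mul1r. Qed.

Lemma is_laurent_w i j : is_laurent (w i j).
Proof.
have -> : w i j = (Nz C)^-1 * pd j i (Nz C).
  by rewrite pd_Nz mulrA (mulVf (@Nz_neq0 C)) mul1r.
apply: is_laurentM is_laurent_Nz_inv _.
have [p ->] := NzP; rewrite pd_pfrac.
by exists p^`M(mxvec_index j i), 0%N; rewrite expr0 divr1.
Qed.

Lemma is_laurent_sigma x : is_poly x -> is_laurent (sg x).
Proof.
move=> [p ->]; elim/mpoly_ring_ind: p => [c|u|p q Lp Lq|p q Lp Lq].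
- by rewrite -cstE sigma_cst; apply: is_laurentC.
- by case/mxvec_indexP: u => i j; rewrite -ZmxE sigma_z; apply: is_laurent_w.
- by rewrite pfracD rmorphD; apply: is_laurentD.
- by rewrite pfracM rmorphM; apply: is_laurentM.
Qed.

Lemma is_laurent_sum (J : Type) (r : seq J) (F : J -> K) :
  (forall j, is_laurent (F j)) -> is_laurent (\sum_(j <- r) F j).
Proof.
move=> LF; apply: big_ind => [||j _]; last exact: LF.
  by rewrite -(rmorph0 (@cst C)); apply: is_laurentC.
exact: is_laurentD.
Qed.

Lemma is_laurent_prod (J : Type) (r : seq J) (F : J -> K) :
  (forall j, is_laurent (F j)) -> is_laurent (\prod_(j <- r) F j).
Proof.
move=> LF; apply: big_ind => [||j _]; last exact: LF.
  by rewrite -(rmorph1 (@cst C)); apply: is_laurentC.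
exact: is_laurentM.
Qed.

Lemma is_laurent_invl f : (forall I, is_poly (f I)) ->
  forall I, is_laurent (invl f I).
Proof.
move=> Pf I; rewrite invlE ffunE; apply: is_laurentM is_laurent_Nz_inv _.
rewrite ffunE; apply: is_laurent_sum => J; apply: is_laurentM.
  by apply: is_laurent_prod => k; apply: is_laurent_w.
by rewrite ffunE; apply: is_laurent_sigma.
Qed.

Lemma symmetric_invl f : is_symmetric f -> is_symmetric (invl f).
Proof.
move=> Sf s I; rewrite invlE ffunE [RHS]ffunE; congr (_ * _).
rewrite ffunE [RHS]ffunE.
rewrite (reindex (fun J : idx => [ffun k => J (s k)])) /=; last first.
  exists (fun J : idx => [ffun k => J ((s^-1)%g k)]) => J _.
    by apply/ffunP => k; rewrite !ffunE permKV.
  by apply/ffunP => k; rewrite !ffunE permK.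
apply: eq_bigr => J _; rewrite ![entrywise _ _ _]ffunE Sf; congr (_ * _).
rewrite [RHS](reindex_inj (@perm_inj _ s)) /=.
by apply: eq_bigr => k _; rewrite !ffunE.
Qed.

(** Inversion takes symmetric polynomial tensors to symmetric Laurent ones, so F- is the image of F+
    under an involution. *)
Lemma FminusE f : Fminus f <-> Fplus (invl f).
Proof.
split=> [[]//|Ff]; have [Sf Pf _] := Ff; rewrite -[f](@invlK C n).
split; [exact: symmetric_invl|exact: is_laurent_invl|by rewrite invlK].
Qed.

Definition swap_blocks (X : 'M[C]_(2 + 2)) : 'M[C]_(2 + 2) :=
  block_mx (drsubmx X) (dlsubmx X) (ursubmx X) (ulsubmx X).

Lemma swap_blockE A B M D :
  swap_blocks (block_mx A B M D) = block_mx D M B A.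
Proof. by rewrite /swap_blocks block_mxKul block_mxKur block_mxKdl block_mxKdr. Qed.

Lemma sp4_swap (X : 'M[C]_(2 + 2)) : sp4 X -> sp4 (swap_blocks X).
Proof.
move=> [A [B [M [BT MT ->]]]]; rewrite swap_blockE; exists (- A^T), M, B.
by split=> //; rewrite linearN /= trmxK opprK.
Qed.

Lemma irreducible_Fminus : (0 < n)%N ->
  irreducible (@sp4 C) (@pi_nl C n) (@Fminus C n).
Proof.
move=> n_gt0; apply: (irreducible_transfer (@invlK C n) (@invlD C n) _ sp4_swap
  _ _ FminusE (irreducible_Fplus C n_gt0)).
- by move=> c f; rewrite invlZ sigma_cst.
- by move=> X _; rewrite swap_blockE submxK.
- by move=> X f [A [B [M [_ _ ->]]]]; rewrite swap_blockE pi_nl_invl.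
Qed.

(** * Transposition and the spaces of right regular functions *)

Local Notation ta := (@tau C).

Definition transpose f : T := entrywise ta f.

Lemma transposeE f I : transpose f I = ta (f I).
Proof. exact: ffunE. Qed.

Lemma transposeK : involutive transpose.
Proof. by move=> f; apply/ffunP => I; rewrite !transposeE tauK. Qed.

Lemma transposeD : {morph transpose : f g / f + g}.
Proof.
move=> f g; apply/ffunP => I.
by rewrite [RHS]ffunE !transposeE [(f + g) I]ffunE rmorphD.
Qed.

Lemma transpose0 : transpose 0 = 0.
Proof. by apply: (addrI (transpose 0)); rewrite -transposeD !addr0. Qed.

Lemma transposeN f : transpose (- f) = - transpose f.
Proof. by apply: (addrI (transpose f)); rewrite -transposeD !subrr transpose0. Qed.

Lemma transpose_sum (r : seq 'I_n) (G : 'I_n -> T) :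
  transpose (\sum_(k <- r) G k) = \sum_(k <- r) transpose (G k).
Proof. exact: (big_morph _ transposeD transpose0). Qed.

Lemma transposeZ x f : transpose (scale x f) = scale (ta x) (transpose f).
Proof.
apply/ffunP => I; rewrite transposeE ffunE rmorphM [RHS]ffunE.
by rewrite transposeE.
Qed.

Lemma trD_transpose X f : entrywise (trD X) (transpose f)
  = transpose (entrywise (trD (map_mx ta X)^T) f).
Proof.
apply/ffunP => I; rewrite transposeE [LHS]ffunE transposeE trD_tau.
by rewrite [entrywise _ _ _]ffunE.
Qed.

Lemma slotr_transpose X k f : slotr (mulop X) k (transpose f)
  = transpose (slotl (mulop (map_mx ta X)^T) k f).
Proof.
apply/ffunP => I; rewrite transposeE ffunE [slotl _ _ _ _]ffunE rmorph_sum.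
apply: eq_bigr => j _; rewrite /mulop ![map_mx *%R _ _ _]mxE transposeE rmorphM.
by rewrite !mxE /= tauK.
Qed.

Lemma map_tau_cmx M : map_mx ta (cmx M) = cmx M.
Proof. by apply/matrixP => i j; rewrite !mxE /= tau_cst. Qed.

Lemma trDN X : trD (- X) =1 (fun x => - trD X x).
Proof.
move=> x; rewrite !trD_pd -sumrN; apply: eq_bigr => i _; rewrite -sumrN.
by apply: eq_bigr => j _; rewrite mxE mulNr.
Qed.

Lemma entrywise_trDN X f : entrywise (trD (- X)) f = - entrywise (trD X) f.
Proof. by apply/ffunP => I; rewrite ffunE trDN [RHS]ffunE [in RHS]ffunE. Qed.

Lemma slotlN X k f : slotl (mulop (- X)) k f = - slotl (mulop X) k f.
Proof.
apply/ffunP => I; rewrite ffunE [RHS]ffunE [in RHS]ffunE -sumrN.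
by apply: eq_bigr => j _; rewrite /mulop !mxE mulNr.
Qed.

Lemma scaleNl x f : scale (- x) f = - scale x f.
Proof. by apply/ffunP => I; rewrite ffunE [RHS]ffunE [in RHS]ffunE mulNr. Qed.

(** Transposing turns A Z into Z A^T. With D = - A^T, the A-part of the right action becomes the
    D-part of the left one and conversely, signs and traces included, while the symmetric B and C
    correspond to themselves. *)
Lemma pi_nr_transpose A B M f : B^T = B -> M^T = M ->
  pi_nr (block_mx A B M (- A^T)) (transpose f)
  = transpose (pi_nl (block_mx A B M (- A^T)) f).
Proof.
move=> BT MT; rewrite pi_nl_blocks /pi_nr.
rewrite block_mxKul block_mxKur block_mxKdl block_mxKdr.
have taT D : (map_mx ta (cmx D))^T = cmx D^T by rewrite map_tau_cmx map_trmx.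
have tazT : (map_mx ta z)^T = z by rewrite map_tauZ trmxK.
have tatr D : ta (\tr (cmx D)) = \tr (cmx D).
  by rewrite -trace_map_mx map_tau_cmx.
have AE : - (entrywise (trD (cmx A *m z)) (transpose f)
      + scale (\tr (cmx A)) (transpose f))
    - \sum_k slotr (mulop (cmx A)) k (transpose f)
    = transpose (blockD (- A^T) f).
  rewrite /blockD 2!transposeD transposeZ transpose_sum trD_transpose.
  rewrite map_mxM trmx_mul taT tazT tatr.
  have -> : cmx (- A^T) = - cmx A^T by rewrite map_mxN.
  rewrite mulmxN entrywise_trDN transposeN opprD; congr (_ + _ + _).
    rewrite -scaleNl; congr (scale _ _).
    by rewrite [RHS]raddfN /= -map_trmx mxtrace_tr.
  rewrite -sumrN; apply: eq_bigr => k _.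
  by rewrite slotlN transposeN slotr_transpose taT.
have BE : - entrywise (trD (cmx B)) (transpose f) = transpose (blockB B f).
  by rewrite /blockB transposeN trD_transpose taT BT.
have ME : entrywise (trD (z *m cmx M *m z)) (transpose f)
     + scale (\tr (z *m cmx M)) (transpose f)
     + \sum_k slotr (mulop (z *m cmx M)) k (transpose f)
    = transpose (blockC M f).
  have zMT : (map_mx ta (z *m cmx M))^T = cmx M *m z.
    by rewrite map_mxM trmx_mul taT tazT MT.
  rewrite /blockC 2!transposeD transposeZ transpose_sum trD_transpose.
  rewrite map_mxM trmx_mul tazT zMT mulmxA; congr (_ + _ + _).
    by rewrite -trace_map_mx -zMT -map_trmx mxtrace_tr; congr (scale (\tr _) _);
       apply/matrixP => i j; rewrite !mxE /= tauK.
  by apply: eq_bigr => k _; rewrite slotr_transpose zMT.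
have DE : entrywise (trD (z *m cmx (- A^T))) (transpose f)
    = transpose (blockA A f).
  rewrite /blockA transposeN trD_transpose map_mxM trmx_mul taT tazT.
  by rewrite linearN /= trmxK map_mxN mulNmx entrywise_trDN transposeN.
rewrite 3!transposeD -AE -BE -ME -DE.
exact: addr_swap_ends.
Qed.

(** Transposition exchanges d_01 and d_10, hence replaces [nabla_plus] by its transpose; this is
    just what passing from right to left multiplication requires. *)
Lemma slotr_nabla_transpose f k :
  slotl (@nabla_plus C) k (transpose f) = transpose (slotr (@nabla_plus C) k f).
Proof.
apply/ffunP => I; rewrite transposeE ffunE [slotr _ _ _ _]ffunE rmorph_sum.
apply: eq_bigr => j _; rewrite transposeE /nabla_plus !mxE.
have t2 x : ta (2 * x) = 2 * ta x by rewrite rmorphM rmorph_nat.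
by case: (ord2P (I k)) => ->; case: (ord2P j) => -> /=;
  rewrite ?rmorphN ?t2 pd_tau //= t2.
Qed.

Lemma right_regular_transpose f : right_regular f <-> left_regular (transpose f).
Proof.
split=> H k; first by rewrite slotr_nabla_transpose H transpose0.
by rewrite -[LHS]transposeK -slotr_nabla_transpose H transpose0.
Qed.

Lemma is_poly_tau x : is_poly x -> is_poly (ta x).
Proof.
move=> [p ->]; elim/mpoly_ring_ind: p => [c|u|p q Lp Lq|p q Lp Lq].
- by rewrite -cstE tau_cst; apply: is_polyC.
- by case/mxvec_indexP: u => i j; rewrite -ZmxE tau_z; apply: is_poly_z.
- by rewrite pfracD rmorphD; apply: is_polyD.
- by rewrite pfracM rmorphM; apply: is_polyM.
Qed.

Lemma is_laurent_tau x : is_laurent x -> is_laurent (ta x).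
Proof.
move=> [p [k ->]]; have [q Eq] := is_poly_tau (ex_intro _ p erefl).
by exists q, k; rewrite fmorph_div rmorphXn /= tau_Nz Eq.
Qed.

Lemma symmetric_transpose f : is_symmetric f -> is_symmetric (transpose f).
Proof. by move=> Sf s I; rewrite !transposeE Sf. Qed.

Lemma GplusE f : Gplus f <-> Fplus (transpose f).
Proof.
split=> [[Sf Pf Rf]|[Sf Pf Rf]]; last first.
  split; last exact/right_regular_transpose.
    by rewrite -[f]transposeK; apply: symmetric_transpose.
  by move=> I; rewrite -[f]transposeK transposeE; apply: is_poly_tau.
split; last exact/right_regular_transpose.
  exact: symmetric_transpose.
by move=> I; rewrite transposeE; apply: is_poly_tau.
Qed.

Lemma invl_transpose f : invl (transpose f) = transpose (invr f).
Proof.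
apply/ffunP => I; rewrite transposeE ffunE [invr f I]ffunE rmorphM.
rewrite fmorphV /= tau_Nz; congr (_ * _).
rewrite ffunE [tpowr _ _ _]ffunE rmorph_sum; apply: eq_bigr => J _ /=.
rewrite rmorphM rmorph_prod mulrC; congr (_ * _).
  rewrite [LHS]ffunE transposeE [entrywise _ _ _]ffunE.
  exact: sigma_tau.
apply: eq_bigr => k _.
have := congr1 (fun M : 'M_2 => M (J k) (I k)) (@map_tau_w C).
by rewrite [LHS]mxE [RHS]mxE => H; apply: esym H.
Qed.

Lemma GminusE f : Gminus f <-> Fminus (transpose f).
Proof.
split=> [[Sf Lf Gf]|[Sf Lf Ff]]; split.
- exact: symmetric_transpose.
- by move=> I; rewrite transposeE; apply: is_laurent_tau.
- by rewrite invl_transpose; apply/GplusE.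
- by rewrite -[f]transposeK; apply: symmetric_transpose.
- by move=> I; rewrite -[f]transposeK transposeE; apply: is_laurent_tau.
- by apply/GplusE; rewrite -invl_transpose.
Qed.

Lemma irreducible_transpose (V V' : T -> Prop) :
  (forall f, V' f <-> V (transpose f)) ->
  irreducible (@sp4 C) (@pi_nl C n) V -> irreducible (@sp4 C) (@pi_nr C n) V'.
Proof.
move=> VV'; apply: (irreducible_transfer transposeK transposeD _ (theta := id)) => //.
  by move=> c f; rewrite transposeZ tau_cst.
by move=> X f [A [B [M [BT MT ->]]]]; apply: pi_nr_transpose.
Qed.

End Intertwining.

Theorem proposition41 (R : realType) (n : nat) (hn : (0 < n)%N) :
  [/\ irreducible (@sp4 R[i]) (@pi_nl R[i] n) (@Fplus R[i] n),
      irreducible (@sp4 R[i]) (@pi_nl R[i] n) (@Fminus R[i] n),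
      irreducible (@sp4 R[i]) (@pi_nr R[i] n) (@Gplus R[i] n) &
      irreducible (@sp4 R[i]) (@pi_nr R[i] n) (@Gminus R[i] n)].
Proof.
have Fp := @irreducible_Fplus R[i] n hn.
have Fm := @irreducible_Fminus R[i] n hn.
split=> //.
- exact: irreducible_transpose (@GplusE _ _) Fp.
- exact: irreducible_transpose (@GminusE _ _) Fm.
Qed.
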